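(* There is an absolute constant $c_0$ such that the following holds. Let $s(n)$ and $\alpha(n)$ be computable functions with $n\ge s(n)\ge \alpha(n)+7\log n+c_0$ for all $n$, and let $m(n)$ be a computable function with $m(n)\le s(n)-7\log n$. Then there exist a computable ensemble of functions $E:\{0,1\}^n\times\{0,1\}^n\to\{0,1\}^{m(n)}$ and a constant $c$ such that for all $n$ and all $x,y\in\{0,1\}^n$ satisfying (i) $C(x)\ge s(n)$ and $C(y)\ge s(n)$, and (ii) $C(x)-C(x\mid y)\le\alpha(n)$ and $C(y)-C(y\mid x)\le \alpha(n)$, we have (1) $C(E(x,y)\mid x)\ge m(n)-\alpha(n)-c$, and (2) $C(E(x,y)\mid y)\ge m(n)-\alpha(n)-c$.
   Context: $C(\cdot)$ denotes plain Kolmogorov complexity with respect to a fixed universal Turing machine, and $C(x\mid y)$ denotes plain conditional Kolmogorov complexity of $x$ given $y$. All logarithms are base 2. *)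

(* Defs.v *)
From Stdlib Require Cantor.
From mathcomp Require Import all_boot all_order all_algebra.
From mathcomp Require Import classical_sets reals exp.
Set Implicit Arguments.
Unset Strict Implicit.
Unset Printing Implicit Defensive.
Import Order.TTheory GRing.Theory Num.Theory.
Local Open Scope classical_set_scope.

(* Model of computation: programs for the partial recursive functions on nat,
   with tuples of arguments packed by the Cantor pairing function. *)
Definition pairn (a b : nat) : nat := Cantor.to_nat (a, b).
Definition unpairn (n : nat) : nat * nat := Cantor.of_nat n.

Inductive machine : Type :=
| MZero
| MSucc
| MLeft
| MRight
| MPair of machine & machine
| MComp of machine & machine
| MPrec of machine & machine
| MMin of machine.

Fixpoint prec_graph (F G : nat -> nat -> Prop) (a k r : nat) : Prop :=
  if k is k'.+1 then
    exists2 r', prec_graph F G a k' r' & G (pairn a (pairn k' r')) r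
  else F a r.

(* eval M n r: the program M halts on input n with output r. *)
Fixpoint eval (M : machine) (n r : nat) : Prop :=
  match M with
  | MZero => r = 0
  | MSucc => r = n.+1
  | MLeft => r = (unpairn n).1
  | MRight => r = (unpairn n).2
  | MPair f g => exists a b, [/\ eval f n a, eval g n b & r = pairn a b]
  | MComp f g => exists2 a, eval g n a & eval f a r
  | MPrec f g => prec_graph (eval f) (eval g) (unpairn n).1 (unpairn n).2 r
  | MMin f => eval f (pairn n r) 0 /\
              forall j, j < r -> exists v, eval f (pairn n j) v.+1
  end.

(* Bijective base-2 numeration (digits 1 and 2): a bijection from {0,1}^* to
   nat. *)
Fixpoint string_code (x : seq bool) : nat :=
  if x is b :: x' then (string_code x').*2 + b.+1 else 0.

(* The bijection 0, -1, 1, -2, 2, ... |-> 0, 1, 2, 3, 4, ... *)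
Definition int_code (z : int) : nat :=
  match z with Posz k => k.*2 | Negz k => k.*2.+1 end.

Definition outputs (M : machine) (p y x : seq bool) : Prop :=
  eval M (pairn (string_code p) (string_code y)) (string_code x).

(* C_U(x | y) <= C_M(x | y) + O(1) for every machine M, with a constant that
   depends only on M. *)
Definition universal (U : machine) : Prop :=
  forall M : machine, exists c : nat, forall p y x : seq bool,
    outputs M p y x ->
    exists2 q : seq bool, outputs U q y x & size q <= size p + c.

(* C_U(x | y), the length of a shortest program. The default value 0 is used
   only if no program exists, which does not happen when U is universal. *)
Definition ccomplexity (U : machine) (x y : seq bool) : nat :=
  xget 0 [set k | (exists2 p : seq bool, outputs U p y x & size p = k) /\
                  (forall p : seq bool, outputs U p y x -> k <= size p)].

Definition complexity (U : machine) (x : seq bool) : nat :=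
  ccomplexity U x [::].

Definition computable_int (f : nat -> int) : Prop :=
  exists M : machine, forall n : nat, eval M n (int_code (f n)).

(* Integer values are needed: the requirement m(n) <= s(n) - 7 log n <= n - 7 log n
   at every n >= 1 forces m(2) <= -5, so no function with values in nat satisfies
   it. For z < 0, {0,1}^z is read as {0,1}^0. *)
Definition string_length (z : int) : nat := if z is Posz k then k else 0.

(* One machine computes all E n; it need not be given n, the common length of
   its two inputs. *)
Definition computable_ensemble (m : nat -> int)
    (E : forall n : nat,
       n.-tuple bool -> n.-tuple bool -> (string_length (m n)).-tuple bool) :
    Prop :=
  exists M : machine, forall (n : nat) (x y : n.-tuple bool),
    outputs M x y (E n x y).

Definition log2 (R : realType) (x : R) : R := (ln x / ln 2)%R.

(* Main.v *)
Require Import Defs.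
From Stdlib Require Cantor.
From mathcomp Require Import boolp classical_sets exp.
From mathcomp Require Import all_boot all_order all_algebra.
From mathcomp Require Import reals zify.
Import Order.TTheory GRing.Theory Num.Theory.
Set Implicit Arguments.
Unset Strict Implicit.
Unset Printing Implicit Defensive.

(** Let [E] be a coloring of [{0,1}^n x {0,1}^n] by [2^m] colors that is balanced:
    if every row of a large rectangle is given a set of at most a fraction [2^-a]
    of the colors, then these colors do not fill much more than a fraction [2^-a]
    of the rectangle. A counting argument (exponential moment of the number of
    hits, union bound over rectangles and sets of colors) shows that balanced
    colorings exist, and the first one is found by exhaustive search.

    Suppose that [z = E x y] has [C(z|x) < m - a] with [a = alpha + 2k], let
    [t = C(y)] and call [v] a candidate for [u] if [C(v) <= t] and
    [C(E u v|u) < m - a]; thus [y] is a candidate for [x]. Rows [u] with at least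
    [2^(t+4-a)] candidates are heavy, and by balance there are fewer than
    [(n+1) 2^a] of them. They can be enumerated from [n] and [t], so that a heavy
    [x] would have complexity at most [a + 4 log n + O(1) < s]. Hence [x] is not
    heavy, and [y] is described, given [x], by its rank among the candidates,
    padded to length [t + 4 - a] so that [t] need not be given, and by [k] in
    unary: [C(y|x) <= t - alpha - k + O(1)]. For large [k] this contradicts
    [C(y) - C(y|x) <= alpha]. *)

Local Open Scope nat_scope.

(** * Computable functions *)

Definition pl (z : nat) : nat := (unpairn z).1.
Definition pr (z : nat) : nat := (unpairn z).2.

Lemma pl_pair a b : pl (pairn a b) = a.
Proof. by rewrite /pl /unpairn /pairn Cantor.cancel_of_to. Qed.

Lemma pr_pair a b : pr (pairn a b) = b.
Proof. by rewrite /pr /unpairn /pairn Cantor.cancel_of_to. Qed.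

Lemma pairn_plr z : pairn (pl z) (pr z) = z.
Proof.
by rewrite /pairn /pl /pr /unpairn -surjective_pairing Cantor.cancel_to_of.
Qed.

Lemma leq_pairn a b : a + b <= pairn a b.
Proof. by have := Cantor.to_nat_non_decreasing a b; rewrite /pairn; lia. Qed.

Lemma leq_pr z : pr z <= z.
Proof. by rewrite -{2}(pairn_plr z); have := leq_pairn (pl z) (pr z); lia. Qed.

Opaque pairn unpairn.

Definition plrE := (pl_pair, pr_pair).

Fixpoint nrec (x0 : nat) (G : nat -> nat -> nat) (k : nat) : nat :=
  if k is k'.+1 then G k' (nrec x0 G k') else x0.

Definition bsum (n : nat) (F : nat -> nat) : nat :=
  nrec 0 (fun i r => r + F i) n.

Definition ball (n : nat) (P : nat -> bool) : bool := bsum n (fun i => ~~ P i) == 0.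
Definition bex (n : nat) (P : nat -> bool) : bool := 0 < bsum n P.

Lemma bsumE n F : bsum n F = \sum_(0 <= i < n) F i.
Proof.
elim: n => [|n IH]; first by rewrite big_geq.
by rewrite big_nat_recr //= -IH.
Qed.

Lemma bsum_ord n F : bsum n F = \sum_(i < n) F i.
Proof. by rewrite bsumE big_mkord. Qed.

Lemma eq_bsum n F G : (forall i, i < n -> F i = G i) -> bsum n F = bsum n G.
Proof. by move=> FG; rewrite !bsum_ord; apply: eq_bigr => i _; apply: FG. Qed.

Lemma leq_bsum n F G : (forall i, i < n -> F i <= G i) -> bsum n F <= bsum n G.
Proof. by move=> FG; rewrite !bsum_ord; apply: leq_sum => i _; apply: FG. Qed.

Lemma leq_bsumn F m n : m <= n -> bsum m F <= bsum n F.
Proof.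
elim: n => [|n IH]; first by case: m.
rewrite leq_eqVlt => /orP[/eqP-> //|/IH]; rewrite /bsum /=; lia.
Qed.

Lemma bsum_size n (P : nat -> bool) : bsum n P = size (filter P (iota 0 n)).
Proof.
rewrite bsumE /index_iota subn0 size_filter.
by elim: (iota 0 n) => [|i s IH]; rewrite ?big_nil ?big_cons ?IH.
Qed.

Lemma ballP n (P : nat -> bool) : reflect (forall i, i < n -> P i) (ball n P).
Proof.
rewrite /ball bsum_ord sum_nat_eq0; apply: (iffP forallP) => [H i lt_in|H i].
  by have := H (Ordinal lt_in); rewrite /= eqb0 negbK.
by rewrite /= H.
Qed.

Lemma bexP n (P : nat -> bool) : reflect (exists2 i, i < n & P i) (bex n P).
Proof.
rewrite /bex lt0n; apply: (iffP idP) => [|[i lt_in Pi]].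
  rewrite bsum_ord sum_nat_eq0 negb_forall => /existsP[i].
  by rewrite /= eqb0 negbK => Pi; exists i.
apply/negP; rewrite bsum_ord sum_nat_eq0 => /forallP/(_ (Ordinal lt_in)).
by rewrite /= Pi.
Qed.

Definition computable (f : nat -> nat) : Prop :=
  exists M, forall n, eval M n (f n).

(** Closure under substitution instead of computability on coded pairs: in this form [computability]
    can apply such a hypothesis directly. *)
Definition computable2 (T : nat -> nat -> nat) : Prop :=
  forall f g, computable f -> computable g -> computable (fun z => T (f z) (g z)).

Definition computable3 (T : nat -> nat -> nat -> nat) : Prop :=
  forall f g h, computable f -> computable g -> computable h -> computable (fun z => T (f z) (g z) (h z)).

Lemma computable_ext f g : (forall n, f n = g n) -> computable f -> computable g.
Proof. by move=> fg [M HM]; exists M => n; rewrite -fg. Qed.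

Lemma computable_id : computable id.
Proof.
exists (MPair MLeft MRight) => n; exists (pl n), (pr n).
by split=> //; rewrite pairn_plr.
Qed.

Lemma computable_comp f g : computable f -> computable g -> computable (fun z => f (g z)).
Proof. by move=> [M HM] [M' HM']; exists (MComp M M') => n; exists (g n). Qed.

Lemma computable_const c : computable (fun => c).
Proof.
elim: c => [|c [M HM]]; first by exists MZero.
by exists (MComp MSucc M) => n; exists c.
Qed.

Lemma computable_succ f : computable f -> computable (fun z => (f z).+1).
Proof. by apply: computable_comp; exists MSucc. Qed.

Lemma computable_pl f : computable f -> computable (fun z => pl (f z)).
Proof. by apply: computable_comp; exists MLeft. Qed.

Lemma computable_pr f : computable f -> computable (fun z => pr (f z)).
Proof. by apply: computable_comp; exists MRight. Qed.

Lemma computable_pair f g : computable f -> computable g -> computable (fun z => pairn (f z) (g z)).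
Proof.
by move=> [M HM] [M' HM']; exists (MPair M M') => n; exists (f n), (g n).
Qed.

Lemma computable_nrec b f G : computable b -> computable f ->
  computable (fun p => G (pl p) (pl (pr p)) (pr (pr p))) ->
  computable (fun z => nrec (f z) (G z) (b z)).
Proof.
move=> [Mb Hb] [Mf Hf] [MG HG].
exists (MComp (MPrec Mf MG) (MPair (MPair MLeft MRight) Mb)) => n.
exists (pairn n (b n)).
  exists n, (b n); split=> //; exists (pl n), (pr n).
  by split=> //; rewrite pairn_plr.
rewrite /= -/(pl _) -/(pr _) !plrE.
elim: (b n) => [|k IH] //=; exists (nrec (f n) (G n) k) => //.
by have := HG (pairn n (pairn k (nrec (f n) (G n) k))); rewrite !plrE.
Qed.

Ltac computable_base :=
  lazymatch goal with
  | |- computable2 _ => let f := fresh "f" in let g := fresh "g" in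
     move=> f g ? ?
  | |- computable3 _ => let f := fresh "f" in let g := fresh "g" in
     let h := fresh "h" in move=> f g h ? ? ?
  | |- computable (fun z => z) => exact computable_id
  | |- computable pl => exact (computable_pl computable_id)
  | |- computable pr => exact (computable_pr computable_id)
  | |- computable (fun _ => ?c) => exact (computable_const c)
  | |- computable (fun z => (@?f z).+1) => apply (@computable_succ f)
  | |- computable (fun z => pl (@?f z)) => apply (@computable_pl f)
  | |- computable (fun z => pr (@?f z)) => apply (@computable_pr f)
  | |- computable (fun z => pairn (@?f z) (@?g z)) => apply (@computable_pair f g)
  | |- computable (fun z => nrec (@?f z) (@?G z) (@?b z)) => apply (@computable_nrec b f G)
  end.

Ltac computable_hyp :=
  match goal with
  | H : computable ?f |- computable ?f => exact H
  | H : computable ?f |- computable (fun z => ?f (@?g z)) => apply (@computable_comp f g H)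
  | H : computable2 ?T |- computable (fun z => ?T (@?f z) (@?g z)) => apply (H f g)
  | H : computable3 ?T |- computable (fun z => ?T (@?f z) (@?g z) (@?h z)) =>
      apply (H f g h)
  | H : computable2 (fun a b => nat_of_bool (@?T a b))
      |- computable (fun z => nat_of_bool (?S (@?f z) (@?g z))) =>
      apply (H f g)
  | H : computable3 (fun a b c => nat_of_bool (@?T a b c))
      |- computable (fun z => nat_of_bool (?S (@?f z) (@?g z) (@?h z))) =>
      apply (H f g h)
  end.

(** A hook: [computable_ops] and [computability] are redefined below as further closure properties
    become available. *)
Ltac computable_ops := fail.
Ltac computability := repeat (cbv beta; first [computable_base | computable_ops | computable_hyp]).

(** * Arithmetic and bounded quantifiers *)

Lemma computable_add f g : computable f -> computable g -> computable (fun z => f z + g z).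
Proof.
move=> cf cg; apply: (@computable_ext (fun z => nrec (f z) (fun i r => r.+1) (g z))).
  by move=> n; elim: (g n) => [|k IH] /=; lia.
by computability.
Qed.

Lemma computable_mul f g : computable f -> computable g -> computable (fun z => f z * g z).
Proof.
move=> cf cg; apply: (@computable_ext (fun z => nrec 0 (fun i r => r + f z) (g z))).
  by move=> n; elim: (g n) => [|k IH] /=; lia.
by computability; apply: computable_add; computability.
Qed.

Lemma computable_exp f g : computable f -> computable g -> computable (fun z => f z ^ g z).
Proof.
move=> cf cg; apply: (@computable_ext (fun z => nrec 1 (fun i r => r * f z) (g z))).
  by move=> n; elim: (g n) => [|k IH] //=; rewrite expnSr IH.
by computability; apply: computable_mul; computability.
Qed.

Lemma computable_pred f : computable f -> computable (fun z => (f z).-1).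
Proof.
move=> cf; apply: (@computable_ext (fun z => nrec 0 (fun i r => i) (f z))).
  by move=> n; case: (f n).
by computability.
Qed.

Lemma computable_sub f g : computable f -> computable g -> computable (fun z => f z - g z).
Proof.
move=> cf cg; apply: (@computable_ext (fun z => nrec (f z) (fun i r => r.-1) (g z))).
  by move=> n; elim: (g n) => [|k IH] /=; lia.
by computability; apply: computable_pred; computability.
Qed.

Lemma computable_neg (p : nat -> bool) :
  computable (fun z => p z : nat) -> computable (fun z => ~~ p z : nat).
Proof.
move=> cp; apply: (@computable_ext (fun z => 1 - p z)); last first.
  by apply: computable_sub; computability.
by move=> n; case: (p n).
Qed.

Lemma computable_eq0 f : computable f -> computable (fun z => f z == 0 : nat).
Proof.
move=> cf; apply: (@computable_ext (fun z => 1 - f z)); last first.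
  by apply: computable_sub; computability.
by move=> n; case: (f n).
Qed.

Lemma computable_leq f g : computable f -> computable g -> computable (fun z => f z <= g z : nat).
Proof. by move=> cf cg; apply: computable_eq0; apply: computable_sub. Qed.

Lemma computable_and (p q : nat -> bool) : computable (fun z => p z : nat) ->
  computable (fun z => q z : nat) -> computable (fun z => p z && q z : nat).
Proof.
move=> cp cq; apply: (@computable_ext (fun z => p z * q z)); last exact: computable_mul.
by move=> n; case: (p n); case: (q n).
Qed.

Lemma computable_or (p q : nat -> bool) : computable (fun z => p z : nat) ->
  computable (fun z => q z : nat) -> computable (fun z => p z || q z : nat).
Proof.
move=> cp cq; apply: (@computable_ext (fun z => ~~ (~~ p z && ~~ q z))).
  by move=> n; rewrite negb_and !negbK.
by apply: computable_neg; apply: computable_and; apply: computable_neg.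
Qed.

Lemma computable_eq (f g : nat -> nat) : computable f -> computable g ->
  computable (fun z => f z == g z : nat).
Proof.
move=> cf cg; apply: (@computable_ext (fun z => (f z <= g z) && (g z <= f z))).
  by move=> n; rewrite -eqn_leq.
by apply: computable_and; apply: computable_leq.
Qed.

Lemma computable_if (p : nat -> bool) f g : computable (fun z => p z : nat) -> computable f ->
  computable g -> computable (fun z => if p z then f z else g z).
Proof.
move=> cp cf cg.
apply: (@computable_ext (fun z => p z * f z + (~~ p z) * g z)); last first.
  by apply: computable_add; apply: computable_mul => //; apply: computable_neg.
by move=> n; case: (p n) => /=; lia.
Qed.

Lemma computable_bsum b F : computable b -> computable (fun p => F (pl p) (pr p)) ->
  computable (fun z => bsum (b z) (F z)).
Proof.
move=> cb cF; rewrite /bsum.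
have cF' : computable (fun z => F (pl z) (pl (pr z))).
  apply: (@computable_ext (fun z => (fun p => F (pl p) (pr p))
            (pairn (pl z) (pl (pr z))))).
    by move=> n; rewrite !plrE.
  by apply: (@computable_comp (fun p => F (pl p) (pr p))) => //; computability.
computability; apply: (@computable_add (fun p => pr (pr p))) => //.
by computability.
Qed.

Lemma computable_ball b (P : nat -> nat -> bool) : computable b ->
  computable (fun p => P (pl p) (pr p) : nat) -> computable (fun z => ball (b z) (P z) : nat).
Proof.
move=> cb cP; apply: (@computable_eq0 (fun z => bsum (b z) (fun i => ~~ P z i))).
apply: (@computable_bsum b (fun z i => ~~ P z i)) => //.
exact: (@computable_neg (fun p => P (pl p) (pr p))).
Qed.

Lemma computable_bex b (P : nat -> nat -> bool) : computable b ->
  computable (fun p => P (pl p) (pr p) : nat) -> computable (fun z => bex (b z) (P z) : nat).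
Proof.
move=> cb cP.
apply: (@computable_leq (fun=> 1) (fun z => bsum (b z) (P z))).
  exact: computable_const.
exact: (@computable_bsum b (fun z i => P z i)).
Qed.

Ltac computable_ops ::=
  lazymatch goal with
  | |- computable (fun z => @?f z + @?g z) => apply (@computable_add f g)
  | |- computable (fun z => @?f z * @?g z) => apply (@computable_mul f g)
  | |- computable (fun z => @?f z - @?g z) => apply (@computable_sub f g)
  | |- computable (fun z => @?f z ^ @?g z) => apply (@computable_exp f g)
  | |- computable (fun z => (@?f z).-1) => apply (@computable_pred f)
  | |- computable (fun z => bsum (@?f z) (@?g z)) => apply (@computable_bsum f g)
  | |- computable (fun z => nat_of_bool (~~ @?f z)) => apply (@computable_neg f)
  | |- computable (fun z => nat_of_bool (@?f z && @?g z)) => apply (@computable_and f g)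
  | |- computable (fun z => nat_of_bool (@?f z || @?g z)) => apply (@computable_or f g)
  | |- computable (fun z => nat_of_bool (@?f z <= @?g z)) => apply (@computable_leq f g)
  | |- computable (fun z => nat_of_bool (@?f z == @?g z)) => apply (@computable_eq f g)
  | |- computable (fun z => nat_of_bool (ball (@?f z) (@?g z))) => apply (@computable_ball f g)
  | |- computable (fun z => nat_of_bool (bex (@?f z) (@?g z))) => apply (@computable_bex f g)
  end.

(** Quotient, binary logarithm and 2-adic valuation are computed below by counting: each is a number
    [q] within the range of a sum whose [i]-th condition holds exactly for [i < q]. *)
Lemma bsum_ltn n q : bsum n (fun i => i < q) = minn n q.
Proof. by elim: n => [|n IH]; rewrite /bsum /= -/(bsum _ _) ?IH; lia. Qed.

Lemma computable_divn f g : computable f -> computable g -> computable (fun z => f z %/ g z).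
Proof.
move=> cf cg; apply: (@computable_ext (fun z => if g z == 0 then 0 else
   bsum (f z) (fun i => i.+1 * g z <= f z))); last first.
  by apply: (@computable_if (fun z => g z == 0) (fun=> 0)); computability.
move=> n; have [->|g0] := eqVneq; first by rewrite divn0.
rewrite (@eq_bsum _ _ (fun i => i < f n %/ g n)); last first.
  by move=> i _; rewrite leq_divRL // lt0n.
by rewrite bsum_ltn; apply/minn_idPr; apply: leq_div.
Qed.

Lemma computable_modn f g : computable f -> computable g -> computable (fun z => f z %% g z).
Proof.
move=> cf cg; apply: (@computable_ext (fun z => f z - f z %/ g z * g z)).
  by move=> n; rewrite [X in X - _](divn_eq (f n) (g n)) addnC addnK.
by computability; apply: computable_divn.
Qed.

Lemma leq_exp2_trunc_log i n : 0 < n -> (2 ^ i <= n) = (i <= trunc_log 2 n).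
Proof.
move=> n0; apply/idP/idP => [|le_i]; first exact: trunc_log_max.
by apply: leq_trans (trunc_logP (ltnSn 1) n0); rewrite leq_pexp2l.
Qed.

Lemma computable_trunc_log f : computable f -> computable (fun z => trunc_log 2 (f z)).
Proof.
move=> cf; apply: (@computable_ext (fun z => bsum (f z) (fun i => 2 ^ i.+1 <= f z)));
  last by computability.
move=> n; case E: (f n) => [|k] //; rewrite -E.
rewrite (@eq_bsum _ _ (fun i => i < trunc_log 2 (f n))); last first.
  by move=> i _; rewrite leq_exp2_trunc_log // E.
rewrite bsum_ltn; apply/minn_idPr; apply: ltnW.
by apply: leq_trans (ltn_expl _ (ltnSn 1)) _; rewrite trunc_logP // E.
Qed.

Lemma computable_logn f : computable f -> computable (fun z => logn 2 (f z)).
Proof.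
move=> cf; apply: (@computable_ext (fun z => bsum (f z) (fun i => f z %% 2 ^ i.+1 == 0)));
  last by computability; apply: computable_modn; computability.
move=> n; case E: (f n) => [|k] //; rewrite -E.
rewrite (@eq_bsum _ _ (fun i => i < logn 2 (f n))); last first.
  by move=> i _; rewrite -/(dvdn _ _) pfactor_dvdn // E.
by rewrite bsum_ltn; apply/minn_idPr; apply: ltnW; apply: ltn_logl; rewrite E.
Qed.

Ltac computable_div :=
  lazymatch goal with
  | |- computable (fun z => @?f z %/ @?g z) => apply (@computable_divn f g)
  | |- computable (fun z => @?f z %% @?g z) => apply (@computable_modn f g)
  | |- computable (fun z => trunc_log 2 (@?f z)) => apply (@computable_trunc_log f)
  | |- computable (fun z => logn 2 (@?f z)) => apply (@computable_logn f)
  | |- computable (fun z => if _ then _ else _) => apply: computable_if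
  end.

Ltac computability ::=
  repeat (cbv beta; first [computable_base | computable_ops | computable_div | computable_hyp]).

(** * Unbounded search *)

(** [MMin] looks for a zero, hence the negation. Nothing is asked of arguments [z] without a
    witness; the enumeration by rank needs this partial form. *)
Lemma min_machine (P : nat -> nat -> bool) : computable2 (fun z i => P z i : nat) ->
  exists M, forall z i, P z i -> (forall j, j < i -> ~~ P z j) -> eval M z i.
Proof.
move=> cP; have [|M HM] := @computable_neg (fun p => P (pl p) (pr p)).
  exact: (cP _ _ (computable_pl computable_id) (computable_pr computable_id)).
exists (MMin M) => z i Pi mini; split.
  by have := HM (pairn z i); rewrite !plrE Pi.
move=> j lt_ji; exists 0; have := HM (pairn z j); rewrite !plrE.
by rewrite mini.
Qed.

Lemma computable_search (P : nat -> nat -> bool) :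
  (forall z, exists i, P z i) -> computable2 (fun z i => P z i : nat) ->
  exists2 f, computable f & forall z, P z (f z).
Proof.
move=> exP /min_machine[M HM]; pose f z := ex_minn (exP z).
exists f => [|z]; last by rewrite /f; case: ex_minnP.
exists M => z; rewrite /f; case: ex_minnP => i Pi mini; apply: HM => // j.
by rewrite ltnNge; apply: contra; apply: mini.
Qed.

Lemma eval_wrap M pre post : computable pre -> computable2 post ->
  exists M', forall z v, eval M (pre z) v -> eval M' z (post z v).
Proof.
move=> [Mpre Hpre] cpost.
have [Mp Hp] : computable (fun p => post (pl p) (pr p)).
  exact: (cpost _ _ (computable_pl computable_id) (computable_pr computable_id)).
exists (MComp Mp (MPair (MPair MLeft MRight) (MComp M Mpre))) => z v Hv.
exists (pairn z v); last by have := Hp (pairn z v); rewrite !plrE.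
exists z, v; split=> //; last by exists (pre z).
by exists (pl z), (pr z); rewrite pairn_plr.
Qed.

(** * Stagewise approximation and enumeration *)

(* Every machine is the limit of a total computable approximation: [st n w] is
   [0] while the computation has not been found to halt at stage [w], and the
   successor of the output afterwards. *)
Definition stages (M : machine) (st : nat -> nat -> nat) : Prop :=
  [/\ computable2 st,
      forall n w w' r, w <= w' -> st n w = r.+1 -> st n w' = r.+1
    & forall n r, eval M n r <-> exists w, st n w = r.+1].

Lemma stages_total M f : computable f -> (forall n r, eval M n r <-> r = f n) ->
  exists st, stages M st.
Proof.
move=> cf Hf; exists (fun n _ => (f n).+1); split=> //.
  by computability.
by move=> n r; rewrite Hf; split=> [->|[_ []]] //; exists 0.
Qed.

Definition bind_st (a : nat) (b : nat -> nat) : nat := if a is a'.+1 then b a' else 0.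

Lemma computable_bind_st f (G : nat -> nat -> nat) : computable f -> computable2 G ->
  computable (fun z => bind_st (f z) (G z)).
Proof.
move=> cf cG; apply: (@computable_ext (fun z => if f z == 0 then 0 else G z (f z).-1)).
  by move=> n; case: (f n).
by apply: (@computable_if (fun z => f z == 0) (fun=> 0)); computability.
Qed.

(** Minimization at a given stage: [f i] is 0 if the value at [i] is still unknown, 1 if it is known
    to be zero, and larger if it is known to be positive. A zero counts only when all earlier values
    are known to be positive. *)
Definition find_st (f : nat -> nat) (w : nat) : nat :=
  nrec 0 (fun j r => if r == 0 then
                       (if ball j (fun i => 1 < f i) && (f j == 1) then j.+1 else 0)
                     else r) w.

Lemma find_stP f w r :
  find_st f w = r.+1 <-> [/\ r < w, f r = 1 & forall j, j < r -> 1 < f j].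
Proof.
elim: w r => [|w IH] r; first by split=> [|[]].
rewrite /find_st /= -/(find_st f w).
case E: (find_st f w) => [|q] /=.
  have N r' : r' < w -> f r' = 1 -> (forall j, j < r' -> 1 < f j) -> False.
    by move=> lt1 f1 fj; have /IH : [/\ r' < w, f r' = 1 & forall j, j < r' -> 1 < f j] by []; rewrite E.
  split.
    case: ifP => // /andP[/ballP H /eqP fw] [<-]; by split.
  move=> [le_rw f1 fj]; move: le_rw; rewrite ltnS leq_eqVlt => /orP[/eqP rw|lt_rw].
    by rewrite -rw f1 eqxx andbT; case: ballP.
  by case: (N r).
have /IH [qw fq fqj] := E.
split=> [[<-]|[rw fr frj]]; first by split=> //; apply: ltnW.
congr _.+1; case: (ltngtP q r) => // [/frj|/fqj]; lia.
Qed.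

Lemma computable_find_st (F : nat -> nat -> nat) b : computable2 F -> computable b ->
  computable (fun z => find_st (F z) (b z)).
Proof.
by move=> cF cb; rewrite /find_st; computability.
Qed.

Ltac computable_stage :=
  lazymatch goal with
  | |- computable (fun z => bind_st (@?f z) (@?G z)) => apply (@computable_bind_st f G)
  | |- computable (fun z => find_st (@?F z) (@?b z)) => apply (@computable_find_st F b)
  | _ => first [computable_base | computable_ops | computable_div | computable_hyp]
  end.
Ltac computability ::= repeat (cbv beta; computable_stage).

(** Induction on the machine, with one stage bound for all subcomputations. A halting computation
    has finitely many of them, so by monotonicity the maximum of their halting stages serves for
    all. *)
Lemma machine_stages M : exists st, stages M st.
Proof.
elim: M => [||||f [sf [cf mf Hf]] g [sg [cg mg Hg]]|f [sf [cf mf Hf]] g [sg [cg mg Hg]]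
  |f [sf [cf mf Hf]] g [sg [cg mg Hg]]|f [sf [cf mf Hf]]].
- by apply: (@stages_total _ (fun=> 0)) => //; computability.
- exact: (stages_total (computable_succ computable_id)).
- exact: (stages_total (computable_pl computable_id)).
- exact: (stages_total (computable_pr computable_id)).
- exists (fun n w => bind_st (sf n w) (fun a => bind_st (sg n w) (fun b => (pairn a b).+1))).
  split.
  + by computability.
  + move=> n w w' r ww'; case Ef: (sf n w) => [|a] //=; case Eg: (sg n w) => [|b] //= <-.
    by rewrite (mf _ _ _ _ ww' Ef) (mg _ _ _ _ ww' Eg).
  + move=> n r; split=> [[a [b [/Hf[w1 E1] /Hg[w2 E2] ->]]]|[w]] /=.
      exists (maxn w1 w2); rewrite (mf _ _ _ _ (leq_maxl _ _) E1).
      by rewrite (mg _ _ _ _ (leq_maxr _ _) E2).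
    case Ef: (sf n w) => [|a] //=; case Eg: (sg n w) => [|b] //= [<-].
    by exists a, b; split=> //; [apply/Hf; exists w | apply/Hg; exists w].
- exists (fun n w => bind_st (sg n w) (fun a => sf a w)).
  split.
  + by computability.
  + move=> n w w' r ww'; case Eg: (sg n w) => [|b] //= Ef.
    by rewrite (mg _ _ _ _ ww' Eg) /= (mf _ _ _ _ ww' Ef).
  + move=> n r; split=> [[a /Hg[w1 E1] /Hf[w2 E2]]|[w]] /=.
      exists (maxn w1 w2); rewrite (mg _ _ _ _ (leq_maxl _ _) E1) /=.
      by rewrite (mf _ _ _ _ (leq_maxr _ _) E2).
    case Eg: (sg n w) => [|b] //= Ef.
    by exists b; [apply/Hg; exists w | apply/Hf; exists w].
- pose st a w := nrec (sf a w)
    (fun i r => bind_st r (fun r' => sg (pairn a (pairn i r')) w)).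
  have mst a k : forall w w' r, w <= w' -> st a w k = r.+1 -> st a w' k = r.+1.
    elim: k => [|k IH] w w' r ww'; first exact: mf.
    rewrite /st /= -!/(st _ _ _); case E: (st a w k) => [|b] //=.
    by rewrite (IH _ _ _ ww' E) /=; apply: mg.
  have Hst a k r : prec_graph (eval f) (eval g) a k r <-> exists w, st a w k = r.+1.
    elim: k r => [|k IH] r /=; first exact: Hf.
    split=> [[r' /IH[w1 E1] /Hg[w2 E2]]|[w]].
      exists (maxn w1 w2); rewrite /st /= -/(st _ _ _).
      rewrite (mst _ _ _ _ _ (leq_maxl _ _) E1) /=.
      by rewrite (mg _ _ _ _ (leq_maxr _ _) E2).
    rewrite /st /= -/(st _ _ _); case E: (st a w k) => [|b] //= Eg.
    by exists b; [apply/IH; exists w | apply/Hg; exists w].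
  exists (fun n w => st (pl n) w (pr n)); split.
  + by rewrite /st; computability.
  + by move=> n w w' r; apply: mst.
  + by move=> n r; apply: Hst.
- exists (fun n w => find_st (fun j => sf (pairn n j) w) w); split.
  + by computability.
  + move=> n w w' r ww' /find_stP[rw fr fj]; apply/find_stP; split.
    * exact: leq_trans ww'.
    * exact: mf fr.
    * move=> j /fj; case E: (sf _ w) => [|b] //.
      by rewrite (mf _ _ _ _ ww' E).
  + move=> n r; split=> [[/Hf[w0 E0] H]|[w /find_stP[rw fr fj]]].
      (* A common stage at which all values below [r] are known to be positive. *)
      have [W HW] : exists W, forall j, j < r -> 1 < sf (pairn n j) W.
        have : forall j, j < r -> exists v, eval f (pairn n j) v.+1 by [].
        elim: r {E0 H} => [|r IH] H; first by exists 0.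
        have [|W HW] := IH; first by move=> j jr; apply: H; apply: ltnW.
        have [v /Hf[w1 E1]] := H r (ltnSn r).
        exists (maxn W w1) => j; rewrite ltnS leq_eqVlt => /orP[/eqP->|/HW].
          by rewrite (mf _ _ _ _ (leq_maxr _ _) E1).
        case E: (sf _ W) => [|b] // b0.
        by rewrite (mf _ _ _ _ (leq_maxl _ _) E).
      (* The stage also bounds the range of the search, hence [r.+1]. *)
      exists (maxn r.+1 (maxn w0 W)); apply/find_stP; split.
      * by rewrite leq_max leqnn.
      * by apply: mf E0; rewrite !leq_max leqnn orbT.
      * move=> j /HW; case E: (sf _ W) => [|b] // b0.
        rewrite (mf _ _ _ _ _ E) //; first by rewrite !leq_max leqnn !orbT.
    split; first by apply/Hf; exists w.
    move=> j /fj; case E: (sf _ w) => [|[|v]] // _.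
    by exists v; apply/Hf; exists w.
Qed.

(* Elements are ranked by the code of the pair formed with the first stage at
   which they are seen. *)
Lemma rank_machine (D : nat -> nat -> nat -> bool) :
  computable3 (fun c v w => D c v w : nat) ->
  (forall c v w w', w <= w' -> D c v w -> D c v w') ->
  exists M, forall c v w N K, D c v w -> (forall v w, D c v w -> v < N) ->
    (forall w, bsum N (fun v => D c v w) <= K) ->
    exists2 j, j < K & eval M (pairn j c) v.
Proof.
move=> cD mD.
pose e c p := D c (pl p) (pr p) && ((pr p == 0) || ~~ D c (pl p) (pr p).-1).
(* On input [pairn j c] the search finds the event [p] that is preceded by exactly [j] events. *)
pose P z p := e (pr z) p && (bsum p (fun q => e (pr z) q) == pl z).
have [|M1 HM1] := @min_machine P; first by rewrite /P /e; computability.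
have [|M HM] := eval_wrap M1 computable_id (post := fun _ v => pl v).
  by computability.
exists M => c v w N K Dw DN DK.
pose w0 := ex_minn (ex_intro _ w Dw).
have ew : e c (pairn v w0).
  rewrite /e !plrE /w0; case: ex_minnP => u Du minu; rewrite Du /=.
  case: u Du minu => //= u _ minu; apply/negP => /minu; by rewrite ltnn.
have e_inj p q : e c p -> e c q -> pl p = pl q -> p = q.
  have lt_e p' q' : e c p' -> e c q' -> pl p' = pl q' -> pr p' < pr q' -> False.
    move=> /andP[Dp _] /andP[_ Dq] Epq ltpq; case/orP: Dq => [/eqP|/negP[]].
      by move=> E; rewrite E in ltpq.
    by rewrite -Epq; apply: mD Dp; rewrite -ltnS prednK //; apply: leq_trans ltpq.
  move=> ep eq Epq; rewrite -(pairn_plr p) -(pairn_plr q) Epq; congr pairn.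
  by case: (ltngtP (pr p) (pr q)) => // /lt_e; [case/(_ ep eq Epq)|case/(_ eq ep (esym Epq))].
set p := pairn v w0 in ew.
have lt_rank p1 p2 : p1 < p2 -> e c p1 -> bsum p1 (e c) < bsum p2 (e c).
  move=> lt12 e1; apply: leq_trans (leq_bsumn _ lt12).
  by rewrite /bsum /= -/(bsum _ _) e1; lia.
exists (bsum p (e c)); last first.
  rewrite -[v](pl_pair v w0); apply: HM; apply: HM1.
    by rewrite /P !plrE ew eqxx.
  move=> j jp; rewrite /P !plrE; apply/negP => /andP[ej /eqP E].
  by have := lt_rank _ _ jp ej; rewrite E ltnn.
apply: leq_trans (DK p); rewrite (_ : (bsum p (e c)).+1 = bsum p.+1 (e c)); last first.
  by rewrite /bsum /= ew addn1.
(* The events up to [p] belong to distinct elements, all of them seen by stage [p], since the stage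
   of an event is at most its code. *)
rewrite !bsum_size -(size_map pl); apply: uniq_leq_size.
  rewrite map_inj_in_uniq ?filter_uniq ?iota_uniq // => p1 p2.
  by rewrite !mem_filter => /andP[e1 _] /andP[e2 _]; apply: e_inj.
move=> u /mapP[q]; rewrite mem_filter mem_iota add0n => /andP[eq /= le_qp] ->.
have Dq : D c (pl q) p.
  have [/andP[Dq _]] := (eq, leq_pr q) => leq; apply: mD Dq.
  exact: leq_trans leq le_qp.
by rewrite mem_filter mem_iota add0n Dq (DN _ _ Dq).
Qed.

(** * Existence of balanced colorings *)

(** Bernoulli's inequality for the power [i] of 1 - 1/(k+1), cleared of denominators. *)
Lemma bernoulli_expn k i : i <= k -> k.+1 ^ i * (k.+1 - i) <= k ^ i * k.+1.
Proof.
elim: i => [|i IH] lt_ik; first by rewrite !expn0 subn0.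
rewrite !expnS; have := IH (ltnW lt_ik).
by set x := k.+1 ^ i; set y := k ^ i; rewrite subSS (subSn (ltnW lt_ik)); nia.
Qed.

(** (1 + 1/k)^k <= 4 for k = 2^a. If k = 2h, Bernoulli with exponent h bounds the square root by
    (2h+1)/(h+1) < 2. *)
Lemma expnS_le4 a : (2 ^ a).+1 ^ (2 ^ a) <= 4 * (2 ^ a) ^ (2 ^ a).
Proof.
case: a => [|a] //; rewrite [2 ^ a.+1]expnS; set h := 2 ^ a.
have h0 : 0 < h by rewrite expn_gt0.
have H : (2 * h).+1 ^ h <= 2 * (2 * h) ^ h.
  have := @bernoulli_expn (2 * h) h; rewrite (_ : (2 * h).+1 - h = h.+1); last lia.
  by set x := _ ^ h; set y := _ ^ h => /(_ _); nia.
have E x : x ^ (2 * h) = (x ^ h) ^ 2 by rewrite mulnC expnM.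
by rewrite !E (_ : 4 = 2 ^ 2) // -expnMn leq_exp2r.
Qed.

Lemma expnS_le a c q : c <= 2 ^ a * q -> (2 ^ a).+1 ^ c <= 4 ^ q * (2 ^ a) ^ c.
Proof.
set k := 2 ^ a => le_c.
have k0 : 0 < k by rewrite expn_gt0.
rewrite -(@leq_pmul2r (k ^ (k * q - c))) ?expn_gt0 ?k0 // -mulnA -expnD subnKC //.
apply: (@leq_trans (k.+1 ^ (k * q))).
  rewrite -[in X in _ <= X](subnKC le_c) expnD leq_pmul2l ?expn_gt0 //.
  by case: (_ - c) => // e; rewrite leq_exp2r.
rewrite !expnM -expnMn; case: q {le_c} => // q; rewrite leq_exp2r //.
exact: expnS_le4.
Qed.

(** A set with at most [k] elements is the set of values of a map from ['I_k] to [option T], with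
    [None] as padding. *)
Lemma card_small_sets (T : finType) k :
  #|[set A : {set T} | #|A| <= k]| <= #|T|.+1 ^ k.
Proof.
pose h (g : {ffun 'I_k -> option T}) := [set x | [exists i, g i == Some x]].
have -> : #|T|.+1 ^ k = #|{: {ffun 'I_k -> option T}}|.
  by rewrite card_ffun card_ord card_option.
apply: leq_trans (leq_imset_card h _); apply: subset_leq_card.
apply/subsetP => A; rewrite inE => le_Ak; apply/imsetP.
exists [ffun i : 'I_k => nth None (map Some (enum A)) i] => //.
apply/setP => x; rewrite inE; apply/idP/existsP => [xA|[i]].
  have lt_x : index x (enum A) < k.
    by apply: leq_trans le_Ak; rewrite cardE index_mem mem_enum.
  exists (Ordinal lt_x); rewrite ffunE /= (nth_map x) ?nth_index ?mem_enum //.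
  by rewrite index_mem mem_enum.
rewrite ffunE => /eqP E; have lt_i : i < size (enum A).
  rewrite ltnNge; apply/negP => le_i; move: E.
  by rewrite nth_default // size_map.
by move: E; rewrite (nth_map x) // => -[<-]; rewrite -mem_enum mem_nth.
Qed.

Lemma card_bigcup_le (I T : finType) (A : {pred I}) (F : I -> {set T}) :
  #|\bigcup_(i in A) F i| <= \sum_(i in A) #|F i|.
Proof.
apply: (big_ind2 (fun (X : {set T}) s => #|X| <= s)) => [|X s Y s' HX HY|//].
  by rewrite cards0.
by apply: leq_trans (leq_add HX HY); rewrite -cardsUI leq_addr.
Qed.

Lemma card_sum_mem (T : finType) (A : {set T}) : #|A| = \sum_x (x \in A).
Proof. by rewrite -sum1_card big_mkcond; apply: eq_bigr => x _; case: (x \in A). Qed.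

Lemma card_set_sum (T : finType) (P : pred T) : #|[set x | P x]| = \sum_x P x.
Proof. by rewrite card_sum_mem; apply: eq_bigr => x _; rewrite inE. Qed.

(** The rows of the rectangle do not appear: [G] will give no colors to the rows outside it. *)
Definition hits (I V : finType) (B : {set I}) (G : {set I * V})
    (tau : {ffun I * I -> V}) : nat :=
  \sum_c (c.2 \in B) && ((c.1, tau c) \in G).

(** The exponential moment factors because the cells are colored independently. *)
Lemma sum_exp_hits (I V : finType) (B : {set I}) (G : {set I * V}) :
  \sum_(tau : {ffun I * I -> V}) 2 ^ hits B G tau =
  \prod_c (#|V| + (c.2 \in B) * #|[set z | (c.1, z) \in G]|).
Proof.
have -> : \prod_c (#|V| + (c.2 \in B) * #|[set z | (c.1, z) \in G]|) =
          \prod_c \sum_z 2 ^ ((c.2 \in B) && ((c.1, z) \in G)).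
  apply: eq_bigr => c _; rewrite card_set_sum -sum1_card big_distrr -big_split.
  by apply: eq_bigr => z _ /=; case: (_ \in B); case: (_ \in G).
rewrite bigA_distr_bigA /=; apply: eq_bigr => tau _.
by rewrite /hits expn_sum.
Qed.

(** Markov's inequality for 2^hits. Each of the at most 2^a q cells of the rectangle contributes a
    factor at most 1 + 2^-a, so the average is at most 4^q, whereas 8q hits give 2^(8q). *)
Lemma card_many_hits (I V : finType) m a q (B1 B2 : {set I}) (G : {set I * V}) :
  #|V| = 2 ^ m -> a <= m -> #|B1| * #|B2| <= 2 ^ a * q ->
  (forall u, #|[set z | (u, z) \in G]| <= (u \in B1) * 2 ^ (m - a)) ->
  #|[set tau | 8 * q <= hits B2 G tau]| * 2 ^ (6 * q) <=
  #|{: {ffun I * I -> V}}|.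
Proof.
move=> cV le_am le_B HG.
have k0 : 0 < 2 ^ a by rewrite expn_gt0.
have Hsum : \sum_(tau : {ffun I * I -> V}) 2 ^ hits B2 G tau <=
            4 ^ q * #|{: {ffun I * I -> V}}|.
  rewrite sum_exp_hits card_ffun cV -{2}(subnK le_am) expnD.
  pose b (c : I * I) : nat := (c.1 \in B1) && (c.2 \in B2).
  apply: (@leq_trans (\prod_(c : I * I) (2 ^ (m - a) * (2 ^ a + b c)))).
    apply: leq_prod => c _; rewrite mulnDr -expnD subnK // leq_add2l.
    have := HG c.1; rewrite /b.
    by case: (c.1 \in B1); case: (c.2 \in B2); rewrite /= ?mul1n ?mul0n ?muln0 ?muln1.
  rewrite big_split /= prod_nat_const expnMn.
  rewrite [in X in _ <= X]mulnCA leq_pmul2l ?expn_gt0 //.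
  have cb : \sum_c b c = #|B1| * #|B2|.
    by rewrite -cardsX /setX card_set_sum.
  rewrite -(@leq_pmul2r ((2 ^ a) ^ (\sum_c b c))) ?expn_gt0 ?k0 //.
  have -> : \prod_c (2 ^ a + b c) * (2 ^ a) ^ (\sum_c b c) =
            (2 ^ a).+1 ^ (\sum_c b c) * (2 ^ a) ^ #|{: I * I}|.
    rewrite -[in RHS]prod_nat_const !expn_sum -!big_split; apply: eq_bigr => c _ /=.
    by rewrite /b; case: (_ && _); rewrite /= ?expn0 ?expn1 ?addn0 ?addn1 ?mul1n ?muln1.
  rewrite -mulnA [_ ^ #|_| * _]mulnC mulnA leq_pmul2r ?expn_gt0 ?k0 //.
  by apply: expnS_le; rewrite cb.
rewrite -(@leq_pmul2r (2 ^ (2 * q))) ?expn_gt0 // -mulnA -expnD.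
rewrite (_ : 6 * q + 2 * q = 8 * q); last lia.
rewrite (expnM 2 2 q) mulnC [in X in _ <= X]mulnC.
apply: leq_trans Hsum; rewrite mulnC -sum_nat_const big_mkcond.
by apply: leq_sum => tau _; rewrite inE; case: ifP => // H; rewrite leq_exp2l.
Qed.

Definition dense_config (I V : finType) (n m a t : nat)
    (X : {set I} * {set I} * {set I * V}) : bool :=
  [&& #|X.1.1| == n.+1 * 2 ^ a, #|X.1.2| <= 2 ^ t.+1 &
      [forall u, #|[set z | (u, z) \in X.2]| <= (u \in X.1.1) * 2 ^ (m - a)]].

Definition fails (I V : finType) (n m a t : nat) : {set {ffun I * I -> V}} :=
  \bigcup_(X in dense_config n m a t)
    [set tau | 8 * (n.+1 * 2 ^ t.+1) <= hits X.1.2 X.2 tau].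

Lemma leq_expS_exp2 N k e : N <= 2 ^ k -> N.+1 ^ e <= 2 ^ (k.+1 * e).
Proof.
move=> le_N; rewrite expnM; case: e => // e; rewrite leq_exp2r // expnS.
by have : 0 < 2 ^ k by [rewrite expn_gt0]; lia.
Qed.

(** With q = (n+1) 2^(t+1), each of the three components is a small set with at most 2^q choices.
    The two size conditions give this for the rows and for the colors: [G] has at most (n+1) 2^m
    elements, each described by n+m bits. *)
Lemma card_dense_config (I V : finType) n m a t :
  #|I| = 2 ^ n -> #|V| = 2 ^ m -> a <= m -> n.+1 * 2 ^ a <= 2 ^ t.+1 ->
  (n + m).+1 * 2 ^ m <= 2 ^ t.+1 ->
  #|@dense_config I V n m a t| <= 2 ^ (3 * (n.+1 * 2 ^ t.+1)).
Proof.
move=> cI cV le_am le1 le2; set q := n.+1 * 2 ^ t.+1.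
set S1 := n.+1 * 2 ^ a.
pose small (T : finType) k := [set A : {set T} | #|A| <= k].
apply: (@leq_trans #|setX (setX (small I S1) (small I (2 ^ t.+1)))
                          (small (I * V)%type (S1 * 2 ^ (m - a)))|).
  apply: subset_leq_card; apply/fintype.subsetP => -[[B1 B2] G].
  rewrite -topredE /= => /and3P[/= /eqP c1 c2 /forallP c3].
  rewrite !inE /= c1 c2 leqnn /=.
  have -> : #|G| = \sum_u #|[set z | (u, z) \in G]|.
    rewrite card_sum_mem.
    rewrite (eq_bigr (fun p => (fun u z => (u, z) \in G : nat) p.1 p.2)); last by case.
    rewrite -(pair_bigA _ (fun u z => (u, z) \in G : nat)) /=.
    by apply: eq_bigr => u _; rewrite card_set_sum.
  apply: leq_trans (leq_sum _ (fun u _ => c3 u)) _.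
  by rewrite -big_distrl /= leq_mul2r -card_sum_mem c1 leqnn orbT.
rewrite !cardsX (_ : 2 ^ (3 * q) = 2 ^ q * 2 ^ q * 2 ^ q); last first.
  by rewrite -!expnD; congr (2 ^ _); lia.
apply: leq_mul; first apply: leq_mul.
- apply: leq_trans (card_small_sets _ _) _.
  apply: leq_trans (leq_expS_exp2 _ (eq_leq cI)) _.
  by rewrite leq_exp2l // leq_mul2l.
- apply: leq_trans (card_small_sets _ _) _.
  exact: leq_trans (leq_expS_exp2 _ (eq_leq cI)) _.
- apply: leq_trans (card_small_sets _ _) _.
  have cIV : #|{: I * V}| <= 2 ^ (n + m) by rewrite card_prod cI cV expnD.
  apply: leq_trans (leq_expS_exp2 _ cIV) _.
  rewrite leq_exp2l // /S1 -mulnA -expnD subnKC // mulnCA.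
  by rewrite leq_mul2l.
Qed.

(** Union bound: at most 2^(3q) configurations, each violated by a fraction at most 2^(-6q) of the
    colorings. *)
Lemma card_fails (I V : finType) n m a t :
  #|I| = 2 ^ n -> #|V| = 2 ^ m -> a <= m -> n.+1 * 2 ^ a <= 2 ^ t.+1 ->
  (n + m).+1 * 2 ^ m <= 2 ^ t.+1 ->
  #|fails I V n m a t| * 2 ^ (3 * (n.+1 * 2 ^ t.+1)) <= #|{: {ffun I * I -> V}}|.
Proof.
move=> cI cV le_am le1 le2; have := card_dense_config cI cV le_am le1 le2.
set q := n.+1 * 2 ^ t.+1 => cX.
have E6 : 2 ^ (3 * q) * 2 ^ (3 * q) = 2 ^ (6 * q).
  by rewrite -expnD; congr (2 ^ _); lia.
rewrite -(@leq_pmul2r (2 ^ (3 * q))) ?expn_gt0 // -mulnA E6.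
apply: (@leq_trans (\sum_(X in @dense_config I V n m a t) #|{: {ffun I * I -> V}}|)).
  apply: (@leq_trans (\sum_(X in @dense_config I V n m a t)
     #|[set tau | 8 * q <= hits X.1.2 X.2 tau]| * 2 ^ (6 * q))).
    rewrite -big_distrl leq_mul2r; apply/orP; right.
    by rewrite /fails -/q; apply: card_bigcup_le.
  apply: leq_sum => -[[B1 B2] G] /and3P[/= /eqP c1 c2 /forallP c3].
  apply: (@card_many_hits _ _ m a q B1) => //.
  by rewrite c1 [_ * 2 ^ a]mulnC -mulnA leq_mul2l /q leq_mul2l c2 !orbT.
by rewrite sum_nat_const mulnC leq_mul2l cX orbT.
Qed.

Lemma exists_notin_bigcup (J T : finType) (F : J -> {set T}) : 0 < #|T| ->
  (forall j, #|F j| * #|J| < #|T|) -> exists x, forall j, x \notin F j.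
Proof.
move=> T0 HF; case: (boolP [exists x, [forall j, x \notin F j]]) => [/existsP[x /forallP]|].
  by exists x.
rewrite negb_exists => /forallP N; exfalso.
have cov : #|T| <= \sum_j #|F j|.
  apply: leq_trans (card_bigcup_le predT F).
  rewrite -cardsT; apply: subset_leq_card; apply/fintype.subsetP => x _.
  have := N x; rewrite negb_forall => /existsP[j]; rewrite negbK => xF.
  by apply/bigcupP; exists j.
have [J0|J0] := posnP #|J|.
  suff E : \sum_j #|F j| = 0 by move: cov; rewrite E leqNgt T0.
  by apply: big1 => j; have := fintype0 j J0.
suff : (\sum_j #|F j|) * #|J| < #|T| * #|J| by rewrite ltn_pmul2r // ltnNge cov.
rewrite big_distrl /= mulnC -sum_nat_const.
have /card_gt0P[j0 _] := J0.
rewrite (bigD1 j0) //= [X in _ < X](bigD1 j0) //= -addSn; apply: leq_add => //.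
by apply: leq_sum => j _; apply: ltnW.
Qed.

(** * Search for a balanced coloring *)

Definition digit (b c i : nat) : nat := (c %/ b ^ i) %% b.

Lemma ltn_digit b c i : 0 < b -> digit b c i < b.
Proof. exact: ltn_pmod. Qed.

(** Through digits, quantifiers over finite functions and sets become bounded quantifiers over
    numbers. *)
Lemma digits_of b K (f : nat -> nat) : (forall i, i < K -> f i < b) ->
  exists2 c, c < b ^ K & forall i, i < K -> digit b c i = f i.
Proof.
elim: K f => [|K IH] f Hf; first by exists 0.
have [|c lt_c Hc] := IH (fun i => f i.+1); first by move=> i; apply: (Hf i.+1).
have f0 := Hf 0 (ltn0Sn _); have b0 : 0 < b by apply: leq_trans f0.
exists (c * b + f 0); first by rewrite expnSr; nia.
case=> [|i] lt_iK; first by rewrite /digit expn0 divn1 modnMDl modn_small.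
by rewrite -Hc // /digit expnS divnMA divnMDl // (divn_small f0) addn0.
Qed.

Lemma computable_digit f g h : computable f -> computable g -> computable h ->
  computable (fun z => digit (f z) (g z) (h z)).
Proof. by move=> *; rewrite /digit; computability. Qed.

Definition bit (c i : nat) : bool := digit 2 c i == 1.

Lemma bits_of K (P : nat -> bool) :
  exists2 c, c < 2 ^ K & forall i, i < K -> bit c i = P i.
Proof.
have [|c lt_c Hc] := @digits_of 2 K P; first by move=> i _; case: (P i).
by exists c => // i lt_i; rewrite /bit Hc //; case: (P i).
Qed.

Lemma computable_bit f g : computable f -> computable g -> computable (fun z => bit (f z) (g z) : nat).
Proof.
by move=> *; apply: (@computable_eq (fun z => digit 2 _ _)); computability; apply: computable_digit; computability.
Qed.

Definition nhits n (B : nat -> bool) (G : nat -> nat -> bool) (f : nat -> nat -> nat) : nat :=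
  bsum (2 ^ n) (fun u => bsum (2 ^ n) (fun v => B v && G u (f u v))).

(* About [n.+1 * 2 ^ t.+1] hits are expected in the rectangle [B1 x B2] if its sides
   are maximal. *)
Definition overhit n m a t (B1 B2 : nat -> bool) (G : nat -> nat -> bool) f : bool :=
  [&& bsum (2 ^ n) B1 == n.+1 * 2 ^ a, bsum (2 ^ n) B2 <= 2 ^ t.+1,
      ball (2 ^ n) (fun u => bsum (2 ^ m) (G u) <= B1 u * 2 ^ (m - a)) &
      8 * (n.+1 * 2 ^ t.+1) <= nhits n B2 G f].

(** The size conditions under which the union bound of [card_fails] succeeds. *)
Definition admissible n m a t : bool :=
  (n.+1 * 2 ^ a <= 2 ^ t.+1) && ((n + m).+1 * 2 ^ m <= 2 ^ t.+1).

(** All [a] and [t] at once, because the coloring is fixed before the deficiency of E x y and the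
    complexity of [y] are known. *)
Definition balanced n m (f : nat -> nat -> nat) : Prop :=
  forall a t, a <= m -> t <= n -> admissible n m a t ->
  forall B1 B2 G, ~~ overhit n m a t B1 B2 G f.

Lemma eq_overhit n m a t B1 B2 G f C1 C2 H g :
  (forall u v, u < 2 ^ n -> v < 2 ^ n -> f u v < 2 ^ m) ->
  (forall u v, u < 2 ^ n -> v < 2 ^ n -> f u v = g u v) ->
  (forall u, u < 2 ^ n -> B1 u = C1 u) -> (forall u, u < 2 ^ n -> B2 u = C2 u) ->
  (forall u z, u < 2 ^ n -> z < 2 ^ m -> G u z = H u z) ->
  overhit n m a t B1 B2 G f = overhit n m a t C1 C2 H g.
Proof.
move=> ltf fg B1C B2C GH; rewrite /overhit /nhits.
congr [&& _ == _, _ <= _, _ & _ <= _].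
- by apply: eq_bsum => u /B1C ->.
- by apply: eq_bsum => u /B2C ->.
- apply/ballP/ballP => HG u lu; have := HG u lu; rewrite B1C //;
  by rewrite (@eq_bsum _ (G u) (H u)) // => z lz; rewrite GH.
- apply: eq_bsum => u lu; apply: eq_bsum => v lv.
  by rewrite -fg // -GH ?ltf // B2C.
Qed.

Definition ftable n m (tau : {ffun 'I_(2 ^ n) * 'I_(2 ^ n) -> 'I_(2 ^ m)}) u v : nat :=
  if insub u is Some i then if insub v is Some j then val (tau (i, j)) else 0 else 0.

Lemma ftableE n m (tau : {ffun 'I_(2 ^ n) * 'I_(2 ^ n) -> 'I_(2 ^ m)}) i j :
  ftable tau (val i) (val j) = val (tau (i, j)).
Proof. by rewrite /ftable !valK. Qed.

Lemma ltn_ftable n m (tau : {ffun 'I_(2 ^ n) * 'I_(2 ^ n) -> 'I_(2 ^ m)}) u v :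
  ftable tau u v < 2 ^ m.
Proof.
rewrite /ftable; case: (insub u) => [i|]; last by rewrite expn_gt0.
by case: (insub v) => [j|]; rewrite ?expn_gt0 /=.
Qed.

Lemma overhit_fails n m a t B1 B2 G (tau : {ffun 'I_(2 ^ n) * 'I_(2 ^ n) -> 'I_(2 ^ m)}) :
  overhit n m a t B1 B2 G (ftable tau) -> tau \in fails _ _ n m a t.
Proof.
move=> /and4P[c1 c2 /ballP c3 c4]; apply/bigcupP.
have cset k (P : nat -> bool) : #|[set u : 'I_k | P u]| = bsum k P.
  by rewrite card_set_sum bsum_ord.
exists ([set u | B1 (val u)], [set v | B2 (val v)], [set p | G (val p.1) (val p.2)]).
  apply/and3P; rewrite /= !cset; split=> //; apply/forallP => u.
  rewrite inE (_ : [set z | _] = [set z : 'I_(2 ^ m) | G u z]); last first.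
    by apply/setP => z; rewrite !inE.
  by rewrite (@cset _ (G u)) c3.
rewrite inE; apply: leq_trans c4 _; rewrite /nhits /hits.
rewrite (eq_bigr (fun c => (fun u v => B2 (val v) && G (val u) (val (tau (u, v))) : nat) c.1 c.2)).
  rewrite -(pair_bigA _ (fun u v => B2 (val v) && G (val u) (val (tau (u, v))) : nat)) /=.
  rewrite bsum_ord; apply: leq_sum => u _; rewrite bsum_ord; apply: leq_sum => v _.
  by rewrite ftableE.
by case=> u v _; rewrite !inE.
Qed.

Lemma exists_balanced n m : exists2 f, forall u v, f u v < 2 ^ m &
  balanced n m f /\ balanced n m (fun u v => f v u).
Proof.
pose Tau := {ffun 'I_(2 ^ n) * 'I_(2 ^ n) -> 'I_(2 ^ m)}.
pose tr (tau : Tau) : Tau := [ffun c => tau (c.2, c.1)].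
have trK : involutive tr by move=> tau; apply/ffunP => -[u v]; rewrite !ffunE.
(* One bad event for each admissible [a], [t] and each orientation. Transposition is a bijection of
   colorings, so both orientations have the same bound. *)
pose F (j : 'I_m.+1 * 'I_n.+1 * bool) : {set Tau} :=
  if admissible n m j.1.1 j.1.2 then
    if j.2 then fails _ _ n m j.1.1 j.1.2 else tr @^-1: fails _ _ n m j.1.1 j.1.2
  else set0.
have T0 : 0 < #|{: Tau}| by rewrite card_ffun expn_gt0 card_ord expn_gt0.
have [|tau Htau] := exists_notin_bigcup (F := F) T0.
  move=> [[a t] b]; rewrite /F /=; case: ifP => [/andP[le1 le2]|_]; last by rewrite cards0.
  have -> : #|if b then fails _ _ n m a t else tr @^-1: fails _ _ n m a t| =
            #|fails ('I_(2 ^ n)) ('I_(2 ^ m)) n m a t|.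
    case: b => //; rewrite on_card_preimset //.
    by apply: onW_bij; exists tr.
  have le_am : a <= m by rewrite -ltnS.
  have := card_fails (card_ord _) (card_ord _) le_am le1 le2.
  rewrite -/Tau; set q := n.+1 * 2 ^ t.+1; set X := #|_|; set Y := #|_| => HX.
  have [->|X0] := posnP X; first by rewrite mul0n.
  (* The number 2 (m+1) (n+1) of events is at most q^3, which is less than 2^(3q). *)
  apply: leq_trans HX; rewrite ltn_pmul2l // !card_prod !card_ord card_bool.
  have lt2 x : x < 2 ^ x by apply: ltn_expl.
  have q2 : 2 <= q by rewrite /q expnS; have := expn_gt0 2 t; nia.
  have qn : n.+1 <= q by rewrite /q; have := expn_gt0 2 t.+1; nia.
  have qm : m.+1 <= q.
    apply: leq_trans (leq_trans _ le2) _; last by rewrite /q leq_pmull.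
    by have := expn_gt0 2 m; nia.
  have -> : 2 ^ (3 * q) = 2 ^ q * 2 ^ q * 2 ^ q by rewrite -!expnD; congr (2 ^ _); lia.
  have := lt2 q; nia.
exists (ftable tau); first exact: ltn_ftable.
split=> a t le_am le_tn adm B1 B2 G; apply/negP.
  move=> /overhit_fails ft.
  by have := Htau (Ordinal (le_am : a < m.+1), Ordinal (le_tn : t < n.+1), true); rewrite /F /= adm ft.
rewrite (@eq_overhit _ _ _ _ _ _ _ _ B1 B2 G (ftable (tr tau))) //.
- move=> /overhit_fails ft.
  have := Htau (Ordinal (le_am : a < m.+1), Ordinal (le_tn : t < n.+1), false).
  by rewrite /F /= adm inE ft.
- by move=> u v _ _; apply: ltn_ftable.
- move=> u v lu lv; have := @ftableE _ _ tau (Ordinal lv) (Ordinal lu) => /= ->.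
  by have := @ftableE _ _ (tr tau) (Ordinal lu) (Ordinal lv) => /= ->; rewrite ffunE.
Qed.

Definition balancedb n m (f : nat -> nat -> nat) : bool :=
  ball m.+1 (fun a => ball n.+1 (fun t => ~~ admissible n m a t ||
    ball (2 ^ 2 ^ n) (fun B1 => ball (2 ^ 2 ^ n) (fun B2 =>
      ball (2 ^ (2 ^ n * 2 ^ m)) (fun G =>
        ~~ overhit n m a t (bit B1) (bit B2) (fun u z => bit G (u * 2 ^ m + z)) f))))).

Lemma balanced_balancedb n m f : balanced n m f -> balancedb n m f.
Proof.
move=> bf; apply/ballP => a le_a; apply/ballP => t le_t.
case: (boolP (admissible n m a t)) => //= adm.
apply/ballP => B1 _; apply/ballP => B2 _; apply/ballP => G _.
exact: bf.
Qed.

Lemma pair_index K u v b : u < K -> v < b -> u * b + v < K * b.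
Proof. by move=> lu lv; nia. Qed.

Lemma balancedb_balanced n m f :
  (forall u v, u < 2 ^ n -> v < 2 ^ n -> f u v < 2 ^ m) ->
  balancedb n m f -> balanced n m f.
Proof.
move=> ltf /ballP bf a t le_am le_tn adm B1 B2 G.
have [c1 l1 E1] := bits_of (2 ^ n) B1; have [c2 l2 E2] := bits_of (2 ^ n) B2.
have [c3 l3 E3] := bits_of (2 ^ n * 2 ^ m) (fun i => G (i %/ 2 ^ m) (i %% 2 ^ m)).
have /ballP/(_ t le_tn) := bf a le_am; rewrite adm /=.
move=> /ballP/(_ _ l1)/ballP/(_ _ l2)/ballP/(_ _ l3).
rewrite (@eq_overhit _ _ _ _ _ _ _ _ B1 B2 G f) // => u z lu lz.
rewrite E3; last exact: pair_index.
by rewrite divnMDl ?expn_gt0 // modnMDl divn_small // addn0 modn_small.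
Qed.

Definition table_of n m c u v : nat := digit (2 ^ m) c (u * 2 ^ n + v).

Lemma eq_balanced n m f g :
  (forall u v, u < 2 ^ n -> v < 2 ^ n -> f u v < 2 ^ m) ->
  (forall u v, u < 2 ^ n -> v < 2 ^ n -> f u v = g u v) ->
  balanced n m f -> balanced n m g.
Proof.
move=> ltf fg bf a t le_am le_tn adm B1 B2 G.
by have := bf a t le_am le_tn adm B1 B2 G; rewrite (@eq_overhit _ _ _ _ _ _ _ _ B1 B2 G g).
Qed.

Ltac computable_digits :=
  lazymatch goal with
  | |- computable (fun z => digit (@?f z) (@?g z) (@?h z)) => apply (@computable_digit f g h)
  | |- computable (fun z => nat_of_bool (bit (@?f z) (@?g z))) => apply (@computable_bit f g)
  | _ => computable_stage
  end.
Ltac computability ::= repeat (cbv beta; computable_digits).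

(** The table is the one with the least code that passes the decidable test in both orientations;
    the counting argument makes the search terminate. *)
Lemma computable_balanced_table : exists T : nat -> nat -> nat -> nat -> nat,
  (forall f g h k, computable f -> computable g -> computable h -> computable k ->
     computable (fun z => T (f z) (g z) (h z) (k z))) /\
  forall n m, [/\ forall u v, T n m u v < 2 ^ m, balanced n m (T n m) &
                  balanced n m (fun u v => T n m v u)].
Proof.
pose P z c := balancedb (pl z) (pr z) (table_of (pl z) (pr z) c) &&
  balancedb (pl z) (pr z) (fun u v => table_of (pl z) (pr z) c v u).
have ltT n m c u v : table_of n m c u v < 2 ^ m by rewrite ltn_digit ?expn_gt0.
have exP z : exists c, P z c.
  set n := pl z; set m := pr z.
  have [f ltf [b1 b2]] := exists_balanced n m.
  have [|c _ Hc] := @digits_of (2 ^ m) (2 ^ n * 2 ^ n) (fun i => f (i %/ 2 ^ n) (i %% 2 ^ n)).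
    by move=> i _; apply: ltf.
  have Tf u v : u < 2 ^ n -> v < 2 ^ n -> f u v = table_of n m c u v.
    move=> lu lv; rewrite /table_of Hc; last exact: pair_index.
    by rewrite divnMDl ?expn_gt0 // modnMDl divn_small // addn0 modn_small.
  exists c; apply/andP; split; apply: balanced_balancedb.
    by apply: eq_balanced b1.
  by apply: eq_balanced b2 => // u v lu lv; apply: Tf.
have [|s cs Hs] := computable_search exP.
  by rewrite /P /balancedb /overhit /nhits /admissible /table_of; computability.
exists (fun n m => table_of n m (s (pairn n m))); split.
  by move=> f g h k *; rewrite /table_of; computability.
move=> n m; have := Hs (pairn n m); rewrite /P !plrE => /andP[b1 b2].
by split=> //; apply: balancedb_balanced.
Qed.

(** * Strings and complexity *)

(** In bijective numeration the strings of one length fill a dyadic interval shifted by one, so a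
    logarithm recovers the length from the code. *)
Lemma string_code_bounds x : 2 ^ size x <= (string_code x).+1 < 2 ^ (size x).+1.
Proof.
elim: x => [|b x /andP[IH1 IH2]] //=.
rewrite !expnS in IH1 IH2 *; apply/andP; split; case: b => /=; lia.
Qed.

Lemma trunc_log_string_code x : trunc_log 2 (string_code x).+1 = size x.
Proof. exact: trunc_log_eq (string_code_bounds x). Qed.

Fixpoint string_of (n v : nat) : seq bool :=
  if n is n'.+1 then odd v :: string_of n' v./2 else [::].

Lemma size_string_of n v : size (string_of n v) = n.
Proof. by elim: n v => //= n IH v; rewrite IH. Qed.

Lemma string_of_code n v : v < 2 ^ n -> string_code (string_of n v) = v + 2 ^ n - 1.
Proof.
elim: n v => [|n IH] v; first by rewrite expn0; case: v.
rewrite expnS => lt_v /=; rewrite IH; last lia.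
by have := odd_double_half v; have := expn_gt0 2 n; rewrite /=; case: (odd v); lia.
Qed.

Lemma string_codeP c : exists x, string_code x = c.
Proof.
set n := trunc_log 2 c.+1.
have l1 : 2 ^ n <= c.+1 by apply: trunc_logP.
have l2 : c.+1 < 2 ^ n.+1 by apply: trunc_log_ltn.
exists (string_of n (c.+1 - 2 ^ n)); rewrite string_of_code; rewrite expnS in l2; lia.
Qed.

Lemma ltn_code_size x k : size x < k -> string_code x < 2 ^ k - 1.
Proof.
move=> lt_x; have /andP[_ l] := string_code_bounds x.
have : 2 ^ (size x).+1 <= 2 ^ k by rewrite leq_exp2l.
lia.
Qed.

(** Programs will carry a parameter [l] in unary as the 2-adic valuation of their code, and the
    remaining data in the odd part. *)
Lemma logn2_odd o l : odd o -> logn 2 (o * 2 ^ l) = l.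
Proof.
move=> oo; rewrite lognM ?expn_gt0 //; last by case: o oo.
by rewrite pfactorK // lognE dvdn2 oo andbF.
Qed.

(** Adds [k] to the integer with code [c], with a negative result cut off at 0. *)
Definition int_shift (c k : nat) : nat :=
  if c %% 2 == 1 then k - (c %/ 2).+1 else c %/ 2 + k.

Lemma int_shiftE z k : (0 <= z + k%:Z)%R -> Posz (int_shift (int_code z) k) = (z + k%:Z)%R.
Proof. by case: z => j; rewrite /int_shift /int_code; case: eqP; lia. Qed.

Definition int_length (c : nat) : nat := if c %% 2 == 1 then 0 else c %/ 2.

Lemma int_lengthE z : int_length (int_code z) = string_length z.
Proof. by case: z => j; rewrite /int_length /int_code /=; case: eqP; lia. Qed.

(** [MLeft] prints its own program, so by universality some program for [x] exists and the default
    value of [xget] does not occur. *)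
Lemma ccomplexityP U x y : universal U ->
  (exists2 p, outputs U p y x & size p = ccomplexity U x y) /\
  forall p, outputs U p y x -> ccomplexity U x y <= size p.
Proof.
move=> HU; have [c Hc] := HU MLeft.
have /Hc[q0 Hq0 _] : outputs MLeft x y x.
  by rewrite /outputs /= -/(pl _) pl_pair.
pose P k := `[< exists2 p : seq bool, outputs U p y x & size p = k >].
have exP : exists k, P k by exists (size q0); apply/asboolP; exists q0.
rewrite /ccomplexity; case: xgetP => [k _ [Hk mink] //|/(_ (ex_minn exP))[]].
case: ex_minnP => k /asboolP Hk mink; split=> // p Hp.
by apply: mink; apply/asboolP; exists p.
Qed.

Lemma ccomplexity_machine U M : universal U ->
  exists c, forall p y x, outputs M p y x -> ccomplexity U x y <= size p + c.
Proof.
move=> HU; have [c Hc] := HU M; exists c => p y x /Hc[q Hq].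
exact/leq_trans/(ccomplexityP x y HU).2.
Qed.

Lemma complexity_size U : universal U ->
  exists c, forall x, complexity U x <= size x + c.
Proof.
move=> /(ccomplexity_machine MLeft)[c Hc]; exists c => x; apply: Hc.
by rewrite /outputs /= -/(pl _) pl_pair.
Qed.

Lemma ccomplexity_complexity U : universal U ->
  exists c, forall x y, ccomplexity U x y <= complexity U x + c.
Proof.
move=> HU; have [c Hc] := ccomplexity_machine (MComp U (MPair MLeft MZero)) HU.
exists c => x y; have [[p Hp Ep] _] := ccomplexityP x [::] HU.
rewrite /complexity -Ep; apply: Hc; exists (pairn (string_code p) 0) => //=.
by exists (string_code p), 0; split=> //; rewrite -/(pl _) pl_pair.
Qed.

(** Turns the hypotheses with real logarithms into inequalities between natural numbers. *)
Lemma log2_gap (R : realType) (n : nat) (a b : int) : 0 < n ->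
  (a%:~R + 7 * log2 (n%:R : R) <= b%:~R)%R -> (a <= b)%R /\ n ^ 7 <= 2 ^ `|b - a|%N.
Proof.
move=> n0 H.
have ln2 : (0 < ln (2 : R))%R by rewrite ln_gt0 // ltr1n.
have lgn : (0 <= log2 (n%:R : R))%R.
  by rewrite /log2 divr_ge0 ?(ltW ln2) ?ln_ge0 ?ler1n.
have le_ab : (a <= b)%R.
  rewrite -(ler_int R); apply: le_trans H.
  by rewrite lerDl mulr_ge0.
split=> //; rewrite -(ler_nat R) !natrX -ler_ln ?posrE ?exprn_gt0 ?ltr0n //.
have lnE : (ln (n%:R : R) = log2 (n%:R : R) * ln 2)%R.
  by rewrite /log2 divfK // gt_eqF.
rewrite !lnXn ?ltr0n // lnE -(mulr_natr _ 7) -(mulr_natr _ `|b - a|%N).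
have -> : (`|b - a|%N%:R = b%:~R - a%:~R :> R)%R.
  by rewrite natr_absz ger0_norm ?subr_ge0 // rmorphB.
rewrite -mulrA mulrC -mulrA ler_pM2l // mulrC lerBrDl.
by rewrite mulrC.
Qed.

Lemma bsum_preimage N K c (g : nat -> nat) :
  bsum N (fun v => bex K (fun p => g p == v + c)) <= K.
Proof.
rewrite bsum_size -[X in _ <= X](size_iota 0 K) -(size_map (fun p => g p - c) (iota 0 K)).
apply: uniq_leq_size; first by rewrite filter_uniq ?iota_uniq.
move=> v; rewrite mem_filter => /andP[/bexP[p lt_p /eqP E] _].
by apply/mapP; exists p; rewrite ?mem_iota // E addnK.
Qed.

Lemma bsum_sub N S (P : nat -> bool) : S <= bsum N P ->
  exists2 B : nat -> bool, (forall u, B u -> P u) & bsum N B = S.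
Proof.
move=> le_S; exists (fun u => P u && (bsum u P < S)); first by move=> u /andP[].
transitivity (minn S (bsum N P)); last exact/minn_idPl.
elim: N {le_S} => [|N IH]; first by rewrite minn0.
rewrite /bsum /= -!/(bsum _ _) IH; case: (P N) => /=; last by rewrite !addn0.
by case: ltnP; lia.
Qed.

(** * Candidates and heavy rows *)

Lemma bsum_leq_size N (P : nat -> bool) : bsum N P <= N.
Proof. by rewrite bsum_size size_filter (leq_trans (count_size _ _)) ?size_iota. Qed.

(** Otherwise choose exactly (n+1) 2^a heavy rows. With at least 2^(t+4-a) hits each, they have
    (n+1) 2^(t+4) hits together, which is the threshold 8 (n+1) 2^(t+1) of [overhit]. *)
Lemma few_heavy_rows n m a t f (B : nat -> bool) (G : nat -> nat -> bool) :
  balanced n m f -> a <= m -> admissible n m a (minn t n) ->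
  bsum (2 ^ n) B <= 2 ^ t.+1 -> (forall u, bsum (2 ^ m) (G u) <= 2 ^ (m - a)) ->
  bsum (2 ^ n) (fun u => 2 ^ (t + 4) <=
    2 ^ a * bsum (2 ^ n) (fun v => B v && G u (f u v))) < n.+1 * 2 ^ a.
Proof.
move=> bf le_am adm cB cG; rewrite ltnNge; apply/negP => /bsum_sub[B1 sub1 card1].
(* C(y) may exceed [n] by a constant, but balance is required for t <= n only. The cut is harmless,
   as there are only 2^n columns. *)
have := bf a (minn t n) le_am (geq_minr _ _) adm B1 B (fun u z => B1 u && G u z).
move=> /negP; apply; apply/and4P; split; first exact/eqP.
- case: (leqP t n) => [le_tn|lt_nt]; first by [].
  by apply: leq_trans (bsum_leq_size _ _) _; rewrite leq_exp2l.
- apply/ballP => u _; case: (B1 u) => /=; rewrite ?mul1n ?mul0n //.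
  by rewrite bsum_ord big1.
rewrite -(@leq_pmul2r (2 ^ a)) ?expn_gt0 //.
apply: (@leq_trans (2 ^ (t + 4) * (n.+1 * 2 ^ a))).
  rewrite -!mulnA mulnCA [in X in _ <= X]mulnCA leq_mul2l /=.
  rewrite (mulnA 8) leq_mul2r addn4 !(expnS 2) ; apply/orP; right.
  have : 2 ^ minn t n <= 2 ^ t by rewrite leq_exp2l // geq_minl.
  lia.
rewrite -card1 /nhits !bsum_ord big_distrr big_distrl; apply: leq_sum => u _ /=.
case B1u: (B1 u); last by rewrite muln0.
by rewrite muln1 mulnC (leq_trans (sub1 _ B1u)).
Qed.

(** The codes below 2^j - 1 are those of the strings shorter than [j]. With this bound as [k], the
    limit of the stages says that the conditional complexity is less than [j]. *)
Definition reached (st : nat -> nat -> nat) (k y w r : nat) : bool :=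
  bex k (fun p => st (pairn p y) w == r.+1).

Lemma reached_mono U st k y w w' r : stages U st -> w <= w' ->
  reached st k y w r -> reached st k y w' r.
Proof.
move=> [_ mst _] ww' /bexP[p lt_p /eqP E]; apply/bexP; exists p => //.
by apply/eqP; apply: mst E.
Qed.

Lemma reached_ccomplexity U st k z y : universal U -> stages U st ->
  ccomplexity U z y < k ->
  exists w, reached st (2 ^ k - 1) (string_code y) w (string_code z).
Proof.
move=> HU [_ _ Hst] lt_k; have [[p /Hst[w Hw] Ep] _] := ccomplexityP z y HU.
exists w; apply/bexP; exists (string_code p); last exact/eqP.
by apply: ltn_code_size; rewrite Ep.
Qed.

Lemma bsum_reached st k y w N c :
  bsum N (fun v => reached st k y w (v + c)) <= k.
Proof.
rewrite (@eq_bsum _ _ (fun v => bex k (fun p => st (pairn p y) w == v + c.+1))).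
  exact: bsum_preimage.
by move=> v _; rewrite /reached addnS.
Qed.

Lemma computable_reached st f g h k : computable2 st -> computable f ->
  computable g -> computable h -> computable k ->
  computable (fun z => reached st (f z) (g z) (h z) (k z) : nat).
Proof. by move=> *; rewrite /reached; computability. Qed.

Lemma computable_int_shift f g : computable f -> computable g ->
  computable (fun z => int_shift (f z) (g z)).
Proof. by move=> *; rewrite /int_shift; computability. Qed.

Lemma computable_int_length f : computable f -> computable (fun z => int_length (f z)).
Proof. by move=> *; rewrite /int_length; computability. Qed.

Definition computable4 (T : nat -> nat -> nat -> nat -> nat) : Prop :=
  forall f g h k, computable f -> computable g -> computable h -> computable k ->
    computable (fun z => T (f z) (g z) (h z) (k z)).

Ltac computable_codes :=
  lazymatch goal with
  | |- computable (fun z => int_shift (@?f z) (@?g z)) =>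
      apply (@computable_int_shift f g)
  | |- computable (fun z => int_length (@?f z)) => apply (@computable_int_length f)
  | H : computable2 ?st
    |- computable (fun z => nat_of_bool (reached ?st (@?f z) (@?g z) (@?h z) (@?k z))) =>
      apply (@computable_reached st f g h k H)
  | H : computable4 ?T |- computable (fun z => ?T (@?f z) (@?g z) (@?h z) (@?k z)) =>
      apply (H f g h k)
  | _ => computable_digits
  end.
Ltac computability ::= repeat (cbv beta; computable_codes).

Definition ofs (n : nat) : nat := 2 ^ n - 1.

(* A string [x] of length [n] is represented by its code, or by its index
   [string_code x - ofs n], which ranges over [0, 2 ^ n). At the limit of the
   stages [w], [cand] says that the string [y] of index [v] satisfies [C(y) <= t]
   and [C(E x y|x) < m n - a]. *)
Definition cand (st : nat -> nat -> nat) (T : nat -> nat -> nat -> nat -> nat)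
    (fm : nat -> nat) (x t a v w : nat) : bool :=
  let n := trunc_log 2 x.+1 in
  [&& v < 2 ^ n, reached st (2 ^ t.+1 - 1) 0 w (v + ofs n) &
      reached st (2 ^ (fm n - a) - 1) x w (T n (fm n) (x - ofs n) v + ofs (fm n))].

(** The threshold 2^(t+4-a) is multiplied by 2^a, so that no truncated subtraction occurs. *)
Definition heavy st T fm (fa : nat -> nat) (k n t u w : nat) : bool :=
  let a := int_shift (fa n) k.*2 in
  (u < 2 ^ n) && (2 ^ (t + 4) <= 2 ^ a * bsum (2 ^ n) (fun v => cand st T fm (u + ofs n) t a v w)).

Lemma cand_mono U st T fm x t a v w w' : stages U st -> w <= w' ->
  cand st T fm x t a v w -> cand st T fm x t a v w'.
Proof.
move=> Hst ww' /and3P[lt_v r1 r2]; apply/and3P; split=> //.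
  exact: reached_mono Hst ww' r1.
exact: reached_mono Hst ww' r2.
Qed.

Lemma heavy_mono U st T fm fa k n t u w w' : stages U st -> w <= w' ->
  heavy st T fm fa k n t u w -> heavy st T fm fa k n t u w'.
Proof.
move=> Hst ww' /andP[lt_u H]; apply/andP; split=> //; apply: leq_trans H _.
rewrite leq_mul2l; apply/orP; right; apply: leq_bsum => v _.
by case E: cand => //; rewrite (cand_mono Hst ww' E).
Qed.

Lemma computable_cand st T fm f g h k l : computable2 st -> computable4 T ->
  computable fm -> computable f -> computable g -> computable h -> computable k ->
  computable l -> computable (fun z => cand st T fm (f z) (g z) (h z) (k z) (l z) : nat).
Proof. by move=> *; rewrite /cand /ofs; computability. Qed.

(** * Short programs for candidates and heavy rows *)

Lemma string_code_index x : string_code x - ofs (size x) + ofs (size x) = string_code x.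
Proof. by have := string_code_bounds x; rewrite /ofs; lia. Qed.

(** The program holds [k] in unary and the rank [j] padded to length [L]. Given [x], it yields [n],
    then [a], then t = L + a - 4. The parameter [k] is in the program and not in the machine,
    because it will be chosen larger than the constant [c]. *)
Lemma light_machine U st T fm fa : universal U -> stages U st -> computable4 T ->
  computable fm -> computable fa ->
  exists c, forall k x y t L w, let n := size x in let a := int_shift (fa n) k.*2 in
    size y = n -> t + 4 = L + a ->
    cand st T fm (string_code x) t a (string_code y - ofs n) w ->
    (forall w, bsum (2 ^ n) (fun v => cand st T fm (string_code x) t a v w) <= 2 ^ L) ->
    ccomplexity U y x <= L + k + 2 + c.
Proof.
move=> HU Hst cT cm ca; have [cst _ _] := Hst.
have [||Mr HMr] := @rank_machine (fun c v w => cand st T fm (pl (pl c)) (pr (pl c)) (pr c) v w).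
- by move=> *; apply: computable_cand; computability.
- by move=> c v w w' ww'; apply: cand_mono Hst ww'.
(* [J] strips the zeros that encode [k] and the bit 1 that ends them. What remains is 2^L + j, whose
   leading bit marks [L]. *)
pose J z := (pl z %/ 2 ^ logn 2 (pl z)) %/ 2.
pose A z := int_shift (fa (trunc_log 2 (pr z).+1)) (logn 2 (pl z)).*2.
pose pre z := pairn (J z - 2 ^ trunc_log 2 (J z))
  (pairn (pairn (pr z) (trunc_log 2 (J z) + A z - 4)) (A z)).
have [||M HM] := @eval_wrap Mr pre (fun z v => v + ofs (trunc_log 2 (pr z).+1)).
- rewrite /pre /J /A.
  apply: (@computable_ext (fun z => pairn ((pl z %/ 2 ^ logn 2 (pl z)) %/ 2 -
      2 ^ trunc_log 2 ((pl z %/ 2 ^ logn 2 (pl z)) %/ 2))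
    (pairn (pairn (pr z) (trunc_log 2 ((pl z %/ 2 ^ logn 2 (pl z)) %/ 2) +
       int_shift (fa (trunc_log 2 (pr z).+1)) (2 * logn 2 (pl z)) - 4))
      (int_shift (fa (trunc_log 2 (pr z).+1)) (2 * logn 2 (pl z)))))).
    by move=> z; rewrite mul2n.
  by computability.
- by rewrite /ofs; computability.
have [c Hc] := ccomplexity_machine M HU.
exists c => k x y t L w n a sy tL cw cL.
have lt_cand v w' : cand st T fm (string_code x) t a v w' -> v < 2 ^ n.
  by move=> /andP[]; rewrite trunc_log_string_code.
have := HMr (pairn (pairn (string_code x) t) a) _ w (2 ^ n) (2 ^ L).
rewrite !plrE => /(_ _ cw lt_cand cL)[j lt_j Hj].
have [q Eq] := string_codeP ((2 ^ L + j).*2.+1 * 2 ^ k).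
have Ek : logn 2 (string_code q) = k.
  by rewrite Eq logn2_odd //= odd_double.
have Eq2 : string_code q %/ 2 ^ k %/ 2 = 2 ^ L + j.
  by rewrite Eq mulnK ?expn_gt0 //; lia.
have EL : trunc_log 2 (2 ^ L + j) = L.
  by apply: trunc_log_eq => //; rewrite expnS; lia.
have Epre : pre (pairn (string_code q) (string_code x)) =
            pairn j (pairn (pairn (string_code x) t) a).
  rewrite /pre /J /A !plrE Ek Eq2 EL trunc_log_string_code -/n -/a -tL.
  by congr (pairn _ (pairn (pairn _ _) _)); lia.
have outq : outputs M q x y.
  have := HM (pairn (string_code q) (string_code x)) (string_code y - ofs n).
  have Ey : string_code y - ofs n + ofs n = string_code y.
    by rewrite -sy string_code_index.
  by rewrite Epre plrE trunc_log_string_code -/n Ey; apply.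
apply: leq_trans (Hc _ _ _ outq) _; rewrite leq_add2r.
have /andP[l1 _] := string_code_bounds q.
suff : 2 ^ size q <= 2 ^ (L + k + 2) by rewrite leq_exp2l.
apply: leq_trans l1 _; rewrite Eq !expnD.
have := expn_gt0 2 k; have : (2 ^ L + j).*2.+2 <= 2 ^ L * 2 ^ 2 by lia.
by rewrite mulnAC; set X := 2 ^ L * _; set Y := 2 ^ k; nia.
Qed.

Lemma computable_heavy st T fm fa k f g h l : computable2 st -> computable4 T ->
  computable fm -> computable fa -> computable f -> computable g -> computable h ->
  computable l -> computable (fun z => heavy st T fm fa k (f z) (g z) (h z) (l z) : nat).
Proof.
move=> *; rewrite /heavy /ofs; computability.
by apply: computable_cand => //; computability.
Qed.

(** Here [k] may be built into the machine. The program holds the rank and two blocks of [l] bits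
    for [t] and [n], with [l] in unary. The bound is exponentiated because [S] need not be a power
    of 2. *)
Lemma heavy_machine U st T fm fa k : universal U -> stages U st -> computable4 T ->
  computable fm -> computable fa ->
  exists c, forall x t l S w, let n := size x in
    n < 2 ^ l -> t < 2 ^ l ->
    heavy st T fm fa k n t (string_code x - ofs n) w ->
    (forall w, bsum (2 ^ n) (fun u => heavy st T fm fa k n t u w) <= S) ->
    2 ^ complexity U x <= 2 ^ (3 * l + 1 + c) * S.
Proof.
move=> HU Hst cT cm ca; have [cst _ _] := Hst.
have [||Mr HMr] := @rank_machine (fun c v w => heavy st T fm fa k (pl c) (pr c) v w).
- by move=> *; apply: computable_heavy => //; computability.
- by move=> c v w w' ww'; apply: heavy_mono Hst ww'.
pose J z := (pl z %/ 2 ^ logn 2 (pl z)) %/ 2.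
pose N z := J z %% 2 ^ logn 2 (pl z).
pose pre z := pairn (J z %/ 2 ^ logn 2 (pl z) %/ 2 ^ logn 2 (pl z))
  (pairn (N z) (J z %/ 2 ^ logn 2 (pl z) %% 2 ^ logn 2 (pl z))).
have [||M HM] := @eval_wrap Mr pre (fun z u => u + ofs (N z)).
- by rewrite /pre /N /J; computability.
- by rewrite /ofs /N /J; computability.
have [c Hc] := ccomplexity_machine M HU.
exists c => x t l S w n lt_n lt_t hw hS.
have lt_heavy u w' : heavy st T fm fa k n t u w' -> u < 2 ^ n by move=> /andP[].
have := HMr (pairn n t) _ w (2 ^ n) S.
rewrite !plrE => /(_ _ hw lt_heavy hS)[j lt_j Hj].
have [q Eq] := string_codeP (((j * 2 ^ l + t) * 2 ^ l + n).*2.+1 * 2 ^ l).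
have Ek : logn 2 (string_code q) = l.
  by rewrite Eq logn2_odd //= odd_double.
have l0 : 0 < 2 ^ l by rewrite expn_gt0.
have EJ y : J (pairn (string_code q) y) = (j * 2 ^ l + t) * 2 ^ l + n.
  by rewrite /J plrE Ek Eq mulnK //; lia.
have EN y : N (pairn (string_code q) y) = n.
  by rewrite /N EJ plrE Ek modnMDl modn_small.
have Epre y : pre (pairn (string_code q) y) = pairn j (pairn n t).
  rewrite /pre EN EJ plrE Ek divnMDl // (divn_small lt_n) addn0.
  by rewrite divnMDl // (divn_small lt_t) addn0 modnMDl (modn_small lt_t).
have outq : outputs M q [::] x.
  have := HM (pairn (string_code q) 0) (string_code x - ofs n).
  by rewrite Epre EN string_code_index; apply.
have le_C := Hc _ _ _ outq.
have /andP[l1 _] := string_code_bounds q.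
apply: (@leq_trans (2 ^ (size q + c))); first by rewrite leq_exp2l.
rewrite expnD [X in _ <= X](_ : _ = (2 ^ (3 * l + 1) * S) * 2 ^ c); last first.
  by rewrite expnD mulnAC.
rewrite leq_mul2r; apply/orP; right; apply: leq_trans l1 _; rewrite Eq.
have -> : 2 ^ (3 * l + 1) = 2 ^ l * 2 ^ l * 2 ^ l * 2.
  by rewrite -!expnD -expnSr; congr (2 ^ _); lia.
move: lt_n lt_t l0; set X := 2 ^ l => lt_n lt_t l0.
have h1 : (j * X + t).+1 <= S * X by nia.
have h2 : ((j * X + t) * X + n).+1 <= S * X * X by nia.
have h3 : ((j * X + t) * X + n).*2.+2 <= S * X * X * 2 by lia.
have : ((j * X + t) * X + n).*2.+2 * X <= S * X * X * 2 * X by rewrite leq_mul2r h3 orbT.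
have -> : S * X * X * 2 * X = X * X * X * 2 * S by lia.
by move: ((j * X + t) * X + n).*2 => Y; lia.
Qed.

Lemma code_lt x : string_code x - ofs (size x) < 2 ^ size x.
Proof. by have := string_code_bounds x; rewrite /ofs expnS; lia. Qed.

Lemma cand_index st T fm n t a u v w : u < 2 ^ n -> v < 2 ^ n ->
  cand st T fm (u + ofs n) t a v w =
  reached st (2 ^ t.+1 - 1) 0 w (v + ofs n) &&
  reached st (2 ^ (fm n - a) - 1) (u + ofs n) w (T n (fm n) u v + ofs (fm n)).
Proof.
move=> lt_u lt_v; rewrite /cand.
have -> : trunc_log 2 (u + ofs n).+1 = n.
  by apply: trunc_log_eq => //; rewrite expnS /ofs; lia.
by rewrite lt_v addnK.
Qed.

(** * Numerical estimates *)

(** [D] and [D2] stand for s - alpha and s - m. Then 2^a n^7 <= 2^t 2^k <= 2^t n and 2^e n^7 <= 2^t,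
    which leaves room for the factors linear in [n]. *)
Lemma admissible_large n e a t k D D2 : 2 ^ k <= n -> 2 <= n -> e <= n ->
  n ^ 7 <= 2 ^ D -> n ^ 7 <= 2 ^ D2 -> a + D <= t + k -> e + D2 <= t ->
  admissible n e a t.
Proof.
move=> le_k n2 le_e HD HD2 Ha He.
have n7 : n * n <= n ^ 7 by rewrite (_ : n * n = n ^ 2) // leq_pexp2l //; lia.
have Ea : 2 ^ a * 2 ^ D <= 2 ^ t * 2 ^ k by rewrite -!expnD leq_exp2l.
have Ee : 2 ^ e * 2 ^ D2 <= 2 ^ t by rewrite -!expnD leq_exp2l.
apply/andP; split; rewrite expnS.
  rewrite -(@leq_pmul2r (2 ^ k)) ?expn_gt0 //.
  apply: (@leq_trans (2 * (2 ^ a * 2 ^ D))); last by rewrite -mulnA leq_mul2l Ea.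
  rewrite -mulnA mulnCA [in X in _ <= X]mulnCA leq_mul2l; apply/orP; right.
  by nia.
apply: (@leq_trans (2 * (2 ^ e * 2 ^ D2))); last by rewrite leq_mul2l Ee.
rewrite mulnC mulnCA leq_mul2l; apply/orP; right.
by nia.
Qed.

(** Since 2^l = O(n), the program for a heavy row gives 2^C = O(n^4 2^a), against 2^a n^7 <=
    2^(C+k). Hence n^3 would be bounded by 2^(k+cb+9), where 2^9 collects 4^3, 2 and 4. *)
Lemma no_heavy_large n a D C k cb c1 l : 2 ^ (k + cb + 9) + c1 + 2 <= n ->
  n ^ 7 <= 2 ^ D -> a + D <= C + k -> 2 ^ l <= 2 * (n + c1 + 1) ->
  2 ^ C <= 2 ^ (3 * l + 1 + cb) * (n.+1 * 2 ^ a) -> False.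
Proof.
move=> le_n HD Ha Hl HC.
have E1 : 2 ^ a * 2 ^ D <= 2 ^ C * 2 ^ k by rewrite -!expnD leq_exp2l.
have E2 : 2 ^ a * n ^ 7 <= 2 ^ a * (2 ^ (3 * l + 1 + cb) * n.+1 * 2 ^ k).
  apply: leq_trans (leq_trans _ E1) _; first by rewrite leq_mul2l HD orbT.
  apply: (@leq_trans (2 ^ (3 * l + 1 + cb) * (n.+1 * 2 ^ a) * 2 ^ k)).
    by rewrite leq_mul2r HC orbT.
  by rewrite leq_eqVlt; apply/orP; left; apply/eqP; lia.
move: E2; rewrite leq_pmul2l ?expn_gt0 // => E2.
have Hl4 : 2 ^ l <= 4 * n by lia.
have E3 : 2 ^ (3 * l + 1 + cb) * n.+1 * 2 ^ k <= 2 ^ (k + cb + 9) * n ^ 4.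
  have -> : 2 ^ (3 * l + 1 + cb) = (2 ^ l) ^ 3 * 2 * 2 ^ cb.
    rewrite -expnM (_ : 3 * l + 1 + cb = l * 3 + 1 + cb); last lia.
    by rewrite (expnD 2 (l * 3 + 1) cb) (expnD 2 (l * 3) 1) expn1.
  have l3 : (2 ^ l) ^ 3 <= 64 * n ^ 3 by rewrite (_ : 64 = 4 ^ 3) // -expnMn leq_exp2r.
  have -> : 2 ^ (k + cb + 9) = 64 * 2 * 2 ^ cb * 4 * 2 ^ k.
    by rewrite !expnD (_ : 2 ^ 9 = 512) //; lia.
  apply: (@leq_trans (64 * n ^ 3 * 2 * 2 ^ cb * (4 * n) * 2 ^ k)).
    rewrite leq_mul2r; apply/orP; right; apply: leq_mul; last lia.
    by rewrite !leq_mul2r l3 !orbT.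
  by rewrite leq_eqVlt; apply/orP; left; apply/eqP; rewrite [n ^ 4]expnSr; lia.
have E4 : n ^ 7 <= 2 ^ (k + cb + 9) * n ^ 4 := leq_trans E2 E3.
have n0 : 0 < n ^ 4 by rewrite expn_gt0; lia.
rewrite (_ : 7 = 3 + 4) // expnD leq_pmul2r // in E4.
have : n * n <= n ^ 3 by rewrite (_ : n * n = n ^ 2) // leq_pexp2l //; lia.
by move: (2 ^ (k + cb + 9)) le_n E4 => X; nia.
Qed.

(** * The bound for one side *)

Lemma card_heavy_lt st T fm fa k n t w : (forall e, balanced n e (T n e)) ->
  let a := int_shift (fa n) k.*2 in
  a <= fm n -> admissible n (fm n) a (minn t n) ->
  bsum (2 ^ n) (fun u => heavy st T fm fa k n t u w) < n.+1 * 2 ^ a.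
Proof.
move=> bT a le_a adm.
have cB : bsum (2 ^ n) (fun v => reached st (2 ^ t.+1 - 1) 0 w (v + ofs n)) <= 2 ^ t.+1.
  by apply: leq_trans (bsum_reached _ _ _ _ _ _) _; rewrite leq_subr.
have cG u : bsum (2 ^ fm n) (fun z =>
    reached st (2 ^ (fm n - a) - 1) (u + ofs n) w (z + ofs (fm n))) <= 2 ^ (fm n - a).
  by apply: leq_trans (bsum_reached _ _ _ _ _ _) _; rewrite leq_subr.
have := few_heavy_rows (bT (fm n)) le_a adm cB cG.
congr (_ < _); apply: eq_bsum => u lt_u; rewrite /heavy lt_u -/a /=.
congr (nat_of_bool (_ <= _ * _)); apply: eq_bsum => v lt_v.
by rewrite cand_index.
Qed.

(** [T] is an arbitrary computable balanced table, so that the statement applies to a table and to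
    its transpose. *)
Lemma extraction_one_sided U (s alpha m : nat -> int) T : universal U ->
  computable_int alpha -> computable_int m -> computable4 T ->
  (forall n e, balanced n e (T n e)) ->
  (forall n, 0 < n -> [/\ (s n <= Posz n)%R, (alpha n <= s n)%R &
                          n ^ 7 <= 2 ^ `|s n - alpha n|%N]) ->
  (forall n, 0 < n -> (m n <= s n)%R /\ n ^ 7 <= 2 ^ `|s n - m n|%N) ->
  exists c : nat, forall x y z, let n := size x in let e := string_length (m n) in
    size y = n ->
    string_code z = T n e (string_code x - ofs n) (string_code y - ofs n) + ofs e ->
    (s n <= Posz (complexity U x))%R -> (s n <= Posz (complexity U y))%R ->
    (Posz (complexity U y) - Posz (ccomplexity U y x) <= alpha n)%R ->
    (m n - alpha n - Posz c <= Posz (ccomplexity U z x))%R.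
Proof.
move=> HU calpha cm cT bT Hs Hm.
pose fm n := int_length (int_code (m n)); pose fa n := int_code (alpha n).
have cfa : computable fa by [].
have cfm : computable fm by apply: computable_int_length; exact: cm.
have [st Hst] := machine_stages U.
have [c1 Hc1] := complexity_size HU.
have [c3 Hc3] := ccomplexity_complexity HU.
have [c2 Hc2] := light_machine HU Hst cT cfm cfa.
(* The light case will give k <= c2 + 6. The summand [c3] ensures alpha n + 2k >= 0, because alpha n
   >= C(y) - C(y|x) >= -c3. *)
pose k := c2 + c3 + 7.
have [cb Hcb] := heavy_machine k HU Hst cT cfm cfa.
pose n0 := 2 ^ (k.*2 + cb + 9) + c1 + 2.
(* The sum makes the claim trivial for all n < n0, including n = 0, where no bounds on [s] and [m]
   are given. *)
pose c := k.*2 + \sum_(i < n0) `|m i - alpha i|%N.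
exists c => x y z n e sy Ez sx_le sy_le dep; rewrite leNgt; apply/negP => ltz.
have le_n0 : n0 <= n.
  rewrite leqNgt; apply/negP => lt_n.
  have : `|m n - alpha n|%N <= \sum_(i < n0) `|m i - alpha i|%N.
    by rewrite (bigD1 (Ordinal lt_n)) //= leq_addr.
  by move: ltz; rewrite /c; lia.
have n_gt0 : 0 < n by apply: leq_trans le_n0; rewrite /n0; lia.
have [sn alphas HD] := Hs n n_gt0; have [ms HD2] := Hm n n_gt0.
have dC : ccomplexity U y x <= complexity U y + c3 by apply: Hc3.
set t := complexity U y in sy_le dep dC.
set d := ccomplexity U y x in dep dC.
pose a := int_shift (fa n) k.*2.
have Ea : Posz a = (alpha n + Posz k.*2)%R.
  by apply: int_shiftE; rewrite /k; lia.
(* The negated claim forces m n > a >= 0, so the output length is [m n] itself. *)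
have [Ee lt_ea] : Posz e = m n /\ ccomplexity U z x < e - a.
  by move: ltz; rewrite /e /c; case: (m n) => j /=; lia.
have Efm : fm n = e by rewrite /fm int_lengthE.
set D := `|_|%N in HD; set D2 := `|_|%N in HD2.
have ED : s n = (alpha n + Posz D)%R by rewrite /D; lia.
have ED2 : s n = (m n + Posz D2)%R by rewrite /D2; lia.
have kn : 2 ^ k.*2 <= n.
  apply: leq_trans le_n0; rewrite /n0 -addnA; apply: leq_trans (leq_addr _ _).
  by rewrite leq_exp2l //; lia.
have n2 : 2 <= n by apply: leq_trans le_n0; rewrite /n0; lia.
have kD : k.*2 <= D.
  have : 2 ^ k.*2 <= 2 ^ D.
    by apply: leq_trans kn (leq_trans _ HD); rewrite -{1}(expn1 n) leq_pexp2l.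
  by rewrite leq_exp2l.
have le_at : a <= t by lia.
have adm : admissible n e a (minn t n).
  (* Both [t] and [n] are at least [s n], hence so is their minimum. *)
  by apply: (admissible_large kn n2 _ HD HD2); lia.
have cH w : bsum (2 ^ n) (fun u => heavy st T fm fa k n t u w) <= n.+1 * 2 ^ a.
  by apply: ltnW; apply: card_heavy_lt; rewrite // Efm -/a //; lia.
have [w cw] : exists w, cand st T fm (string_code x) t a (string_code y - ofs n) w.
  have [w1 r1] := reached_ccomplexity HU Hst (ltnSn (complexity U y)).
  have [w2 r2] := reached_ccomplexity HU Hst lt_ea.
  have lt_y : string_code y - ofs n < 2 ^ n by have := code_lt y; rewrite sy.
  have Ey : string_code y - ofs n + ofs n = string_code y.
    by rewrite -sy string_code_index.
  exists (maxn w1 w2); rewrite -{1}(string_code_index x) cand_index ?code_lt //.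
  rewrite -/n Efm -Ez Ey string_code_index.
  by rewrite (reached_mono Hst (leq_maxl _ _) r1) (reached_mono Hst (leq_maxr _ _) r2).
(* Heaviness is only enumerated by stages, so the case distinction is classical. *)
have [[w' hw]|nh] := pselect (exists w, heavy st T fm fa k n t (string_code x - ofs n) w).
  (* Enough bits for both [n] and t <= n + c1. *)
  pose l := (trunc_log 2 (n + c1 + 1)).+1.
  have ll : n + c1 + 1 < 2 ^ l by apply: trunc_log_ltn.
  have lu : 2 ^ l <= 2 * (n + c1 + 1).
    by rewrite expnS leq_mul2l trunc_logP // addn1.
  have tn : t <= n + c1 by have := Hc1 y; rewrite sy.
  have lt_nl : n < 2 ^ l by lia.
  have lt_tl : t < 2 ^ l by lia.
  apply: (no_heavy_large (k := k.*2) le_n0 HD _ lu (Hcb x t l _ w' lt_nl lt_tl hw cH)).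
  by move: ED Ea sx_le; lia.
have cL w' : bsum (2 ^ n) (fun v => cand st T fm (string_code x) t a v w') <= 2 ^ (t + 4 - a).
  rewrite leqNgt; apply/negP => lt_L; apply: nh; exists w'; rewrite /heavy code_lt /=.
  rewrite string_code_index -/a; apply: leq_trans (leq_mul (leqnn _) (ltnW lt_L)).
  by rewrite -expnD leq_exp2l //; lia.
have tL : t + 4 = (t + 4 - a) + a by lia.
have := Hc2 k x y t (t + 4 - a) w sy tL cw cL; rewrite -/d.
by move: Ea dep le_at; rewrite /k; lia.
Qed.

(** * Both sides together *)

Local Open Scope ring_scope.

Theorem theorem4 (R : realType) (U : machine) (HU : universal U) :
  exists c0 : nat,
  forall s alpha m : nat -> int,
    computable_int s -> computable_int alpha -> computable_int m ->
    (forall n : nat, (0 < n)%N ->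
       s n <= n%:Z /\
       (alpha n)%:~R + 7 * log2 n%:R + c0%:R <= (s n)%:~R :> R) ->
    (forall n : nat, (0 < n)%N ->
       (m n)%:~R <= (s n)%:~R - 7 * log2 n%:R :> R) ->
    exists E : forall n : nat,
        n.-tuple bool -> n.-tuple bool -> (string_length (m n)).-tuple bool,
    computable_ensemble E /\
    exists c : nat,
    forall (n : nat) (x y : n.-tuple bool),
      (s n <= (complexity U x)%:Z /\ s n <= (complexity U y)%:Z) ->
      ((complexity U x)%:Z - (ccomplexity U x y)%:Z <= alpha n /\
       (complexity U y)%:Z - (ccomplexity U y x)%:Z <= alpha n) ->
      m n - alpha n - c%:Z <= (ccomplexity U (E n x y) x)%:Z /\
      m n - alpha n - c%:Z <= (ccomplexity U (E n x y) y)%:Z.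
Proof.
(* For large [n] the factor n^7 outweighs all constants, and small [n] are absorbed by [c]; thus c_0
   = 0 works. *)
exists 0%N => s alpha m _ calpha cm Hs Hm.
have [T [cT HT]] := computable_balanced_table.
have Hs' n : (0 < n)%N -> [/\ s n <= n%:Z, alpha n <= s n &
    (n ^ 7 <= 2 ^ `|s n - alpha n|%N)%N].
  move=> n0; have [le_sn] := Hs n n0; rewrite addr0.
  by case/(log2_gap n0).
have Hm' n : (0 < n)%N -> m n <= s n /\ (n ^ 7 <= 2 ^ `|s n - m n|%N)%N.
  by move=> n0; apply: (@log2_gap R _ _ _ n0); rewrite -lerBrDr Hm.
(* The transposed table gives (2), with [x] and [y] exchanged. *)
have cT' : computable4 (fun n e u v => T n e v u) by move=> f g h k *; apply: cT.
have bT n e : balanced n e (T n e) by have [_ ? _] := HT n e.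
have bT' n e : balanced n e (fun u v => T n e v u) by have [_ _ ?] := HT n e.
have [c Hc] := extraction_one_sided HU calpha cm cT bT Hs' Hm'.
have [c' Hc'] := extraction_one_sided HU calpha cm cT' bT' Hs' Hm'.
pose code n x y := let e := string_length (m n) in
  T n e (string_code x - ofs n)%N (string_code y - ofs n)%N.
pose E n (x y : n.-tuple bool) :=
  Tuple (introT eqP (size_string_of (string_length (m n)) (code n x y))).
have EE n (x y : n.-tuple bool) :
    string_code (E n x y) = (code n x y + ofs (string_length (m n)))%N.
  rewrite string_of_code; last by have [lt _ _] := HT n (string_length (m n)); apply: lt.
  by have := expn_gt0 2 (string_length (m n)); rewrite /ofs; lia.
exists E; split.
  (* The machine recovers [n] as the length of its first input. *)
  have [M HM] : computable (fun z => let n := trunc_log 2 (pl z).+1 in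
      let e := int_length (int_code (m n)) in
      (T n e (pl z - ofs n) (pr z - ofs n) + ofs e)%N).
    have cfm : computable (fun n => int_length (int_code (m n))).
      exact: (computable_int_length cm).
    have [fm [cfm' Efm]] : exists fm, computable fm /\
      forall n, fm n = int_length (int_code (m n)) by eexists; split; first exact: cfm.
    apply: (@computable_ext (fun z => T (trunc_log 2 (pl z).+1) (fm (trunc_log 2 (pl z).+1))
       (pl z - ofs (trunc_log 2 (pl z).+1)) (pr z - ofs (trunc_log 2 (pl z).+1)) +
       ofs (fm (trunc_log 2 (pl z).+1)))%N); first by move=> z; rewrite Efm.
    have cT4 : computable4 T := cT.
    by rewrite /ofs; computability.
  exists M => n x y; rewrite /outputs EE.
  have := HM (pairn (string_code x) (string_code y)).
  by rewrite /= !plrE trunc_log_string_code size_tuple int_lengthE.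
exists (c + c')%N => n x y [sx sy] [dx dy]; split.
  have := Hc x y (E n x y); rewrite !size_tuple => /(_ erefl (EE n x y) sx sy dy).
  lia.
have := Hc' y x (E n x y); rewrite !size_tuple => /(_ erefl (EE n x y) sy sx dx).
lia.
Qed.
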